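(* For a finitely generated group $G$ the following are equivalent: (1) for some finite generating set $S$ of $G$ closed under inverses there is a constant $K$ with $\Delta_S(n)\le n/6+K$ for all $n\ge1$; (2) $G$ is (word) hyperbolic; (3) for every finite generating set $S$ of $G$ closed under inverses there are constants $Q,R$ with $\Delta_S(n)\le Q\log n+R$ for all $n\ge1$.
   Context: For a finite generating set $S$ of $G$ closed under inverses, $\Gamma$ is the Cayley diagram (edge labelled $s$ from $g$ to $gs$), with word metric $d(g,g')$ = length of a shortest word in $S$ representing $g^{-1}g'$, extended to $\Gamma$ by making each edge isometric to the unit interval. A cycle of length $n\ge1$ is a sequence $g_0,\dots,g_n$ in $G$ with an edge from each $g_{i-1}$ to $g_i$ and $g_n=g_0$. A (diagonal) triangulation of a circle: distinguish one or more points on the circle and join some of them by chords such that no two chords meet in the interior, the interior is divided into triangles, and each arc between neighbouring distinguished points is a side of a triangle; circles with at most three distinguished points count as triangulated with no chords. A triangulation of the cycle $g_0,\dots,g_n$ is such a triangulation of a circle with distinguished points $p_1,\dots,p_n$ labelled $g_1,\dots,g_n$ counterclockwise; a chord from $p_i$ to $p_j$ has length $d(g_i,g_j)$; a $k$-triangulation has all chord lengths $\le k$. $\Delta_S(n)$ is the least $k$ such that every cycle of length at most $n$ in $\Gamma$ has a $k$-triangulation. $\log$ is to base 2. $G$ is hyperbolic if for some (equivalently any) such $S$ there is $\delta$ such that in every geodesic triangle in $\Gamma$ each point of any side is within distance $\delta$ of some point on one of the other two sides. *)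

(* Defs.v *)
From Stdlib Require Import Reals Lra Lia List Arith.
From Stdlib Require Import ClassicalEpsilon ClassicalDescription.
Import ListNotations.
Open Scope R_scope.

Record Grp := {
  car :> Type;
  mul : car -> car -> car;
  inv : car -> car;
  one : car;
  mulA : forall x y z, mul x (mul y z) = mul (mul x y) z;
  mul1g : forall x, mul one x = x;
  mulVg : forall x, mul (inv x) x = one }.

Arguments mul {g}. Arguments inv {g}. Arguments one {g}.

Section Defs.
Variable G : Grp.

Definition wprod (w : list G) : G := fold_right mul one w.

(* the least natural number satisfying P (well defined when P is inhabited) *)
Definition least (P : nat -> Prop) : nat :=
  epsilon (inhabits 0%nat) (fun n => P n /\ forall m, P m -> (n <= m)%nat).

Definition generates (S : list G) : Prop :=
  forall g : G, exists w : list G,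
    Forall (fun x => In x S \/ In (inv x) S) w /\ wprod w = g.

Definition closed_inv (S : list G) : Prop :=
  forall s, In s S -> In (inv s) S.

Definition fin_sym_gen (S : list G) : Prop := generates S /\ closed_inv S.

Definition word_len (S : list G) (g : G) : nat :=
  least (fun n => exists w : list G,
    Forall (fun x => In x S) w /\ length w = n /\ wprod w = g).

Definition wdist (S : list G) (g h : G) : nat := word_len S (mul (inv g) h).

Definition is_cycle (S : list G) (n : nat) (c : nat -> G) : Prop :=
  (forall i, (1 <= i <= n)%nat -> exists s, In s S /\ c i = mul (c (i - 1)%nat) s)
  /\ c n = c 0%nat.

(* [ktri S k c i j]: the polygon formed by the distinguished points
   p_i, p_(i+1), ..., p_j (with labels c i, ..., c j) and closed by the
   side p_i p_j admits a division into triangles by non-crossing chords,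
   each chord p_a p_b (b >= a+2) having length d(c a, c b) <= k.
   A triangulation of the polygon is determined by the triangle (i, m, j)
   on the side p_i p_j and triangulations of the two sub-polygons. *)
Inductive ktri (S : list G) (k : nat) (c : nat -> G) : nat -> nat -> Prop :=
| kt_side i : ktri S k c i (Datatypes.S i)
| kt_split i m j :
    (i < m)%nat -> (m < j)%nat ->
    ktri S k c i m -> ktri S k c m j ->
    (m = Datatypes.S i \/ (wdist S (c i) (c m) <= k)%nat) ->
    (j = Datatypes.S m \/ (wdist S (c m) (c j) <= k)%nat) ->
    ktri S k c i j.

(* the cycle c 0..c n has a k-triangulation (points p_1..p_n labelled
   c 1..c n; at most three points: no chords needed) *)
Definition has_ktri (S : list G) (k n : nat) (c : nat -> G) : Prop :=
  (n <= 3)%nat \/ ktri S k c 1 n.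

Definition DeltaS (S : list G) (n : nat) : nat :=
  least (fun k => forall (m : nat) (c : nat -> G),
    (1 <= m <= n)%nat -> is_cycle S m c -> has_ktri S k m c).

(* a point of Gamma: the point at distance pt from pv on the edge labelled ps
   from pv to pv*ps *)
Record point := Pt { pv : G; ps : G; pt : R }.

Definition valid (S : list G) (p : point) : Prop :=
  In (ps p) S /\ 0 <= pt p <= 1.

Definition gdist (S : list G) (p q : point) : R :=
  let g := pv p in let s := ps p in let t := pt p in
  let h := pv q in let u := ps q in let r := pt q in
  let dd a b := INR (wdist S a b) in
  let via := Rmin (Rmin (t + dd g h + r) (t + dd g (mul h u) + (1 - r)))
                  (Rmin ((1 - t) + dd (mul g s) h + r)
                        ((1 - t) + dd (mul g s) (mul h u) + (1 - r))) in
  if excluded_middle_informative (g = h /\ s = u)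
  then Rmin via (Rabs (t - r)) else via.

Definition geodesic (S : list G) (x y : point) (L : R) (c : R -> point) : Prop :=
  0 <= L /\
  (forall a, 0 <= a <= L -> valid S (c a)) /\
  gdist S (c 0) x = 0 /\ gdist S (c L) y = 0 /\
  (forall a b, 0 <= a <= L -> 0 <= b <= L -> gdist S (c a) (c b) = Rabs (a - b)).

(* every geodesic triangle is delta-thin (stated for the first side; the
   other sides are covered by relabelling the triangle) *)
Definition thin_triangles (S : list G) (delta : R) : Prop :=
  forall (x y z : point) (L1 L2 L3 : R) (c1 c2 c3 : R -> point),
    valid S x -> valid S y -> valid S z ->
    geodesic S x y L1 c1 -> geodesic S y z L2 c2 -> geodesic S z x L3 c3 ->
    forall a, 0 <= a <= L1 ->
      exists b, (0 <= b <= L2 /\ gdist S (c1 a) (c2 b) <= delta)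
             \/ (0 <= b <= L3 /\ gdist S (c1 a) (c3 b) <= delta).

Definition hyperbolic : Prop :=
  exists S : list G, fin_sym_gen S /\ exists delta : R, thin_triangles S delta.

Definition finitely_generated : Prop := exists S : list G, fin_sym_gen S.

End Defs.

Definition log2 (x : R) : R := ln x / ln 2.

(* Main.v *)
Require Import Defs.
From Stdlib Require Import Reals List Lra Lia Arith ZArith Classical ClassicalEpsilon ClassicalDescription.
Import ListNotations.
Open Scope R_scope.

(** (1) => (2).  For Lipschitz functions f, g on G consider the discrete line
    integral of g df along closed walks; it is additive when a loop is cut by a
    chord.  A triangulation with chords of length at most n/6 + K contains a
    chord cutting the loop between n/3 and 2n/3, and the two resulting loops
    have lengths p, q with p^2 + q^2 <= (1/4 + 25/36) n^2 + O(n), where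
    1/4 + 25/36 < 1.  Starting from the trivial quadratic bound and iterating,
    the integral is at most e n^2 + C for every e > 0.  If r is the exact
    thinness of a geodesic triangle, attained at x, then x lies on a loop of
    length O(r) which, apart from a piece of the side through x, stays at
    distance about r from x; clamped distance functions make the integral along
    it of order r^2, so r is bounded.

    (2) => (3).  Thinness and bisection place every point of a geodesic within
    O(log n) of any path of length n with the same ends.  Applied to the
    midpoint of a chord of length O(log n), this gives a vertex of the cycle
    at which the chord can be replaced by two chords within the same bound.
    The argument takes place in the metric of the hyperbolic generating set but
    works for cycles with steps of bounded length, hence for cycles in any
    other generating set. *)

(** * Least elements and group identities *)

Lemma least_spec (P : nat -> Prop) :
  (exists n, P n) -> P (least P) /\ forall m, P m -> (least P <= m)%nat.
Proof.
  intros [n Hn]. unfold least. apply epsilon_spec.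
  destruct (dec_inh_nat_subset_has_unique_least_element P) as [m [[Hm Hm'] _]].
  - intro; apply classic.
  - now exists n.
  - now exists m.
Qed.

Section Group.
Context {G : Grp}.
Implicit Types x y z : G.

Lemma mulKg x y : mul (inv x) (mul x y) = y.
Proof. now rewrite mulA, mulVg, mul1g. Qed.

Lemma mulgV x : mul x (inv x) = one.
Proof.
  transitivity (mul (mul (inv (inv x)) (inv x)) (mul x (inv x))).
  - now rewrite mulVg, mul1g.
  - now rewrite <- mulA, (mulKg x), mulVg.
Qed.

Lemma mulg1 x : mul x one = x.
Proof. now rewrite <- (mulVg _ x), mulA, mulgV, mul1g. Qed.

Lemma mulKVg x y : mul x (mul (inv x) y) = y.
Proof. now rewrite mulA, mulgV, mul1g. Qed.

Lemma invgK x : inv (inv x) = x.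
Proof. now rewrite <- (mulg1 (inv (inv x))), <- (mulVg _ x), mulKg. Qed.

Lemma mulgK x y : mul (mul x y) (inv y) = x.
Proof. now rewrite <- mulA, mulgV, mulg1. Qed.

End Group.

(** * Walks, line integrals and the word metric *)

Section Metric.
Context {G : Grp} (S : list G).
Hypothesis HS : fin_sym_gen G S.

Definition edge (u v : G) : Prop := exists s, In s S /\ v = mul u s.

Fixpoint walk (u : G) (l : list G) : Prop :=
  match l with nil => True | v :: l' => edge u v /\ walk v l' end.

Fixpoint endp (u : G) (l : list G) : G :=
  match l with nil => u | v :: l' => endp v l' end.

(** Twice the trapezoidal rule for the integral of [g] against [df]. The weight is symmetric in [u]
    and [v], so the sum changes sign when the walk is reversed and a chord run in both directions
    cancels. *)
Fixpoint integral (f g : G -> R) (u : G) (l : list G) : R :=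
  match l with
  | nil => 0
  | v :: l' => (g u + g v) * (f v - f u) + integral f g v l'
  end.

Lemma integral_app f g u l1 l2 :
  integral f g u (l1 ++ l2) = integral f g u l1 + integral f g (endp u l1) l2.
Proof.
  revert u; induction l1 as [|v l1 IH]; intro u; simpl; [|rewrite IH]; ring.
Qed.

Lemma edge_sym u v : edge u v -> edge v u.
Proof.
  intros [s [Hs ->]]. exists (inv s). split; [now apply HS | now rewrite mulgK].
Qed.

Lemma endp_app u l1 l2 : endp u (l1 ++ l2) = endp (endp u l1) l2.
Proof. revert u; induction l1; simpl; auto. Qed.

Lemma walk_app u l1 l2 : walk u (l1 ++ l2) <-> walk u l1 /\ walk (endp u l1) l2.
Proof. revert u; induction l1 as [|v l1 IH]; simpl; intro u; [|rewrite IH]; tauto. Qed.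

Lemma endp_in u l : In (endp u l) (u :: l).
Proof. revert u; induction l as [|v l IH]; intro u; [|right; apply IH]; now left. Qed.

Lemma walk_of_word u w : Forall (fun x => In x S) w ->
  exists l, walk u l /\ endp u l = mul u (wprod G w) /\ length l = length w.
Proof.
  intro H; revert u; induction H as [|s w Hs _ IH]; intro u; simpl.
  - exists nil. now rewrite mulg1.
  - destruct (IH (mul u s)) as [l [Hl [He Hn]]].
    exists (mul u s :: l). rewrite mulA. simpl. repeat split; auto. now exists s.
Qed.

Lemma word_of_walk u l : walk u l ->
  exists w, Forall (fun x => In x S) w /\ length w = length l /\
    wprod G w = mul (inv u) (endp u l).
Proof.
  revert u; induction l as [|v l IH]; intros u; simpl.
  - intros _. exists nil. now rewrite mulVg.
  - intros [[s [Hs ->]] Hl]. destruct (IH _ Hl) as [w [Hw [Hn Hp]]].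
    exists (s :: w). simpl. repeat split; auto.
    rewrite Hp, <- (mulKg u (mul s _)), (mulA _ u s), mulKVg. reflexivity.
Qed.

Notation d := (wdist G S).

Lemma wdist_word u v : exists w, Forall (fun x => In x S) w /\
  length w = d u v /\ wprod G w = mul (inv u) v.
Proof.
  unfold wdist, word_len. apply least_spec.
  destruct HS as [Hg Hc]. destruct (Hg (mul (inv u) v)) as [w [Hw Hp]].
  exists (length w), w. repeat split; auto.
  eapply Forall_impl; [|exact Hw]. intros x [H|H]; auto.
  rewrite <- (invgK x). now apply Hc.
Qed.

Lemma geodesic_walk u v : exists l, walk u l /\ endp u l = v /\ length l = d u v.
Proof.
  destruct (wdist_word u v) as [w [Hw [Hn Hp]]].
  destruct (walk_of_word u w Hw) as [l [Hl [He Hl']]].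
  exists l. rewrite He, Hp, mulKVg. repeat split; auto. congruence.
Qed.

Lemma wdist_walk u l : walk u l -> (d u (endp u l) <= length l)%nat.
Proof.
  intro H. destruct (word_of_walk u l H) as [w [Hw [Hn Hp]]].
  rewrite <- Hn. unfold wdist, word_len. apply least_spec; eauto.
Qed.

Lemma wdist_refl u : d u u = 0%nat.
Proof. generalize (wdist_walk u nil I). simpl. lia. Qed.

Lemma wdist_triangle u v w : (d u w <= d u v + d v w)%nat.
Proof.
  destruct (geodesic_walk u v) as [l [Hl [He Hn]]].
  destruct (geodesic_walk v w) as [l' [Hl' [He' Hn']]].
  subst v. rewrite <- Hn, <- Hn', <- length_app, <- He', <- endp_app.
  apply wdist_walk, walk_app; auto.
Qed.

Lemma walk_rev u l : walk u l -> exists l', walk (endp u l) l' /\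
  endp (endp u l) l' = u /\ length l' = length l /\
  (forall w, In w (endp u l :: l') -> In w (u :: l)) /\
  forall f g, integral f g (endp u l) l' = - integral f g u l.
Proof.
  revert u; induction l as [|v l IH]; intro u; simpl.
  - intros _. exists nil. simpl. repeat split; auto. intros; ring.
  - intros [He Hl]. destruct (IH _ Hl) as [l' [H1 [H2 [H3 [H4 H5]]]]].
    exists (l' ++ [u]). rewrite walk_app, endp_app, H2, length_app. simpl.
    repeat split; auto; [now apply edge_sym | lia | |
      intros f g; rewrite integral_app, H5, H2; simpl; ring].
    intros w [Hw | Hw].
    + right. apply H4. now left.
    + apply in_app_or in Hw. destruct Hw as [Hw | [<- | []]]; auto.
      right. apply H4. now right.
Qed.

Lemma wdist_sym u v : d u v = d v u.
Proof.
  assert (H : forall u v, (d v u <= d u v)%nat).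
  { clear u v; intros u v. destruct (geodesic_walk u v) as [l [Hl [<- Hn]]].
    destruct (walk_rev u l Hl) as [l' [H1 [H2 [H3 _]]]].
    rewrite <- Hn, <- H3. generalize (wdist_walk _ _ H1). now rewrite H2. }
  apply Nat.le_antisymm; apply H.
Qed.

Lemma wdist_edge u v : edge u v -> (d u v <= 1)%nat.
Proof. intro H. apply (wdist_walk u [v]). now split. Qed.

Lemma wdist_le1 u v : (d u v <= 1)%nat -> u = v \/ edge u v.
Proof.
  destruct (geodesic_walk u v) as [l [Hl [He Hn]]]. rewrite <- Hn.
  destruct l as [|a [|b l]]; simpl in *; intro; [now left | right | lia].
  subst. tauto.
Qed.

Lemma walk_wdist_mem u l w : walk u l -> In w (u :: l) ->
  (d u w + d w (endp u l) <= length l)%nat.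
Proof.
  revert u; induction l as [|v l IH]; intros u Hl Hw.
  - destruct Hw as [<- | []]. simpl. rewrite !wdist_refl. lia.
  - destruct Hw as [<- | Hw].
    + rewrite wdist_refl. now apply wdist_walk.
    + destruct Hl as [He Hl]. generalize (IH _ Hl Hw), (wdist_edge _ _ He), (wdist_triangle u v w).
      simpl. lia.
Qed.

(** Consecutive points may coincide, in which case no step is made; hence the length is only bounded
    from above. *)
Lemma lazy_segment_walk (P : nat -> G) i j :
  (i <= j)%nat -> (forall k, (i <= k < j)%nat -> (d (P k) (P (Datatypes.S k)) <= 1)%nat) ->
  exists l, walk (P i) l /\ endp (P i) l = P j /\ (length l <= j - i)%nat /\
    forall w, In w (P i :: l) -> exists k, (i <= k <= j)%nat /\ w = P k.
Proof.
  intros Hij. induction Hij as [|j Hij IH]; intro Hs.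
  - exists nil. simpl. repeat split; auto; [lia|]. intros w [<- | []]. exists i. split; [lia | auto].
  - destruct IH as [l [H1 [H2 [H3 H4]]]]; [intros; apply Hs; lia|].
    destruct (wdist_le1 _ _ (Hs j ltac:(lia))) as [He | He].
    + exists l. rewrite <- He. split; [|split; [|split; [lia|]]]; auto.
      intros w Hw. destruct (H4 w Hw) as [k [Hk ->]]. exists k. split; [lia | auto].
    + exists (l ++ [P (Datatypes.S j)]). rewrite walk_app, endp_app, H2, length_app. cbn [walk endp length].
      split; [tauto|]. split; [reflexivity|]. split; [lia|].
      intros w Hw. rewrite app_comm_cons in Hw. apply in_app_or in Hw.
      destruct Hw as [Hw | [<- | []]].
      * destruct (H4 w Hw) as [k [Hk ->]]. exists k. split; [lia | auto].
      * exists (Datatypes.S j). split; [lia | auto].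
Qed.

(** The vertices lying on some geodesic from [a] to [b]; this avoids choosing a geodesic. *)
Definition between (a b x : G) : Prop := (d a x + d x b = d a b)%nat.

Lemma between_exists a b k : (k <= d a b)%nat ->
  exists x, between a b x /\ d a x = k.
Proof.
  intro Hk. destruct (geodesic_walk a b) as [l [Hl [He Hn]]].
  rewrite <- (firstn_skipn k l) in Hl, He. rewrite walk_app in Hl. rewrite endp_app in He.
  destruct Hl as [H1 H2]. apply wdist_walk in H1, H2.
  rewrite He, length_skipn in H2. rewrite length_firstn in H1.
  exists (endp a (firstn k l)). unfold between.
  generalize (wdist_triangle a (endp a (firstn k l)) b). lia.
Qed.

Lemma walk_nth u l i e : walk u l -> (i < length l)%nat ->
  edge (nth i (u :: l) e) (nth (Datatypes.S i) (u :: l) e).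
Proof.
  revert u i; induction l as [|v l IH]; simpl; intros u i H Hi; [lia|].
  destruct i as [|i]; [tauto|].
  apply (IH v i (proj2 H)). lia.
Qed.

Lemma nth_endp u l e : nth (length l) (u :: l) e = endp u l.
Proof. revert u; induction l as [|v l IH]; intro u; [reflexivity | apply IH]. Qed.

(** * Cutting loops by chords *)

Lemma firstn_endp u l a e : (a <= length l)%nat ->
  endp u (firstn a l) = nth a (u :: l) e.
Proof.
  revert u a; induction l as [|v l IH]; intros u [|a] Ha; try reflexivity; [simpl in Ha; lia|].
  apply IH. simpl in Ha. lia.
Qed.

Lemma cycle_of_walk u l : walk u l -> endp u l = u ->
  is_cycle G S (length l) (fun i => nth i (u :: l) u).
Proof.
  intros Hl He. split.
  - intros i Hi. generalize (walk_nth u l (i - 1) u Hl ltac:(lia)).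
    replace (Datatypes.S (i - 1)) with i by lia. auto.
  - now rewrite nth_endp.
Qed.

Lemma ktri_fan k c j : (forall i, (1 <= i <= j)%nat -> (d (c 1%nat) (c i) <= k)%nat) ->
  (2 <= j)%nat -> ktri G S k c 1 j.
Proof.
  intros H Hj. induction Hj as [|j Hj IH]; [constructor|].
  refine (kt_split G S k c 1 j _ _ _ _ (kt_side G S k c j) _ (or_introl eq_refl)); [lia | lia | |].
  - apply IH. intros i Hi. apply H. lia.
  - right. apply H. lia.
Qed.

(** [least] is meaningful only for an inhabited predicate. Fan triangulations, whose chords are at
    most [m - 1] long for a cycle of length [m], show that [n] qualifies. *)
Lemma DeltaS_spec n c : (1 <= n)%nat -> is_cycle G S n c -> has_ktri G S (DeltaS G S n) n c.
Proof.
  intros Hn Hc. unfold DeltaS.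
  match goal with |- has_ktri _ _ (least ?P) _ _ => assert (H : P (least P)) end.
  { apply least_spec. exists n. clear c Hc Hn. intros m c Hm [Hc _].
    destruct (le_lt_dec m 3) as [H3|H3]; [now left | right].
    apply ktri_fan; [|lia]. intros i Hi.
    enough (d (c 1%nat) (c i) <= i - 1)%nat by lia.
    destruct Hi as [Hi Him]. induction Hi as [|i Hi IH]; [rewrite wdist_refl; lia|].
    destruct (Hc (Datatypes.S i) ltac:(lia)) as [s Hs].
    replace (Datatypes.S i - 1)%nat with i in * by lia.
    generalize (wdist_triangle (c 1%nat) (c i) (c (Datatypes.S i))),
      (wdist_edge (c i) (c (Datatypes.S i)) (ex_intro _ s Hs)), (IH ltac:(lia)). lia. }
  apply H; [lia | auto].
Qed.

Lemma DeltaS_le n k :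
  (forall m c, (1 <= m <= n)%nat -> is_cycle G S m c -> has_ktri G S k m c) ->
  (DeltaS G S n <= k)%nat.
Proof. intro H. exact (proj2 (least_spec _ (ex_intro _ k H)) k H). Qed.

(** Descent into the larger of the two sub-polygons: it spans at least half of [j - i], hence more
    than a third of [n], and the descent stops once it spans at most two thirds. A bare side never
    satisfies the last hypothesis, because [2 <= n]. *)
Lemma ktri_balanced_chord k c n i j : (2 <= n)%nat -> ktri G S k c i j -> (2 * n < 3 * (j - i))%nat ->
  exists a b, (i <= a /\ a < b /\ b <= j)%nat /\ (n <= 3 * (b - a) <= 2 * n)%nat /\
    (b = Datatypes.S a \/ (d (c a) (c b) <= k)%nat).
Proof.
  intros Hn Hk. induction Hk as [i | i m j Him Hmj H1 IH1 H2 IH2 C1 C2]; intro Hl; [lia|].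
  destruct (le_lt_dec (j - m) (m - i)) as [Hle|Hle].
  - destruct (le_lt_dec (3 * (m - i)) (2 * n)) as [Hs|Hs].
    + exists i, m. repeat split; auto; lia.
    + destruct (IH1 Hs) as [a [b [Hab Hr]]]. exists a, b. split; [lia | auto].
  - destruct (le_lt_dec (3 * (j - m)) (2 * n)) as [Hs|Hs].
    + exists m, j. repeat split; auto; lia.
    + destruct (IH2 Hs) as [a [b [Hab Hr]]]. exists a, b. split; [lia | auto].
Qed.

(** The loop is [p1 ++ p2 ++ p3] with a balanced chord spanning [p2]. A geodesic [q] along the chord
    closes both parts, backwards after [p2] and forwards between [p1] and [p3], so its contributions
    cancel. Length 4 is where the range from 1 to [length l] starts to span more than two thirds of
    the length. *)
Lemma split_closed_walk u l : walk u l -> endp u l = u -> (4 <= length l)%nat ->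
  exists (v : G) (l1 l2 : list G) (m k : nat),
    (k <= Datatypes.S (DeltaS G S (length l)))%nat /\
    (length l <= 3 * m <= 2 * length l)%nat /\
    walk v l1 /\ endp v l1 = v /\ length l1 = (m + k)%nat /\
    walk u l2 /\ endp u l2 = u /\ length l2 = (length l - m + k)%nat /\
    forall f g, integral f g u l = integral f g v l1 + integral f g u l2.
Proof.
  intros Hl He Hn.
  destruct (DeltaS_spec (length l) _ ltac:(lia) (cycle_of_walk u l Hl He)) as [H|H]; [lia|].
  destruct (ktri_balanced_chord _ _ (length l) _ _ ltac:(lia) H ltac:(lia))
    as [a [b [Hab [Hm Hd]]]].
  rewrite <- !firstn_endp in Hd by lia.
  replace (firstn b l) with (firstn a l ++ firstn (b - a) (skipn a l)) in Hd.
  2:{ rewrite <- (firstn_skipn a l) at 3. rewrite firstn_app, length_firstn, firstn_firstn.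
      f_equal; f_equal; lia. }
  set (p1 := firstn a l) in *. set (p2 := firstn (b - a) (skipn a l)) in *.
  set (p3 := skipn b l).
  assert (El : l = p1 ++ p2 ++ p3).
  { unfold p1, p2, p3. replace b with ((b - a) + a)%nat at 2 by lia.
    now rewrite <- skipn_skipn, !firstn_skipn. }
  assert (L1 : length p1 = a) by (unfold p1; rewrite length_firstn; lia).
  assert (L2 : length p2 = (b - a)%nat)
    by (unfold p2; rewrite length_firstn, length_skipn; lia).
  assert (L3 : length p3 = (length l - b)%nat) by (unfold p3; now rewrite length_skipn).
  rewrite El in Hl, He. rewrite !walk_app in Hl. rewrite !endp_app in He.
  destruct Hl as [W1 [W2 W3]]. rewrite endp_app in Hd.
  (* The successor covers a balanced chord that is a side of the polygon, of length at most 1. *)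
  assert (Hk : (d (endp u p1) (endp (endp u p1) p2) <= Datatypes.S (DeltaS G S (length l)))%nat).
  { destruct Hd as [Hd|Hd]; [|lia]. generalize (wdist_walk _ _ W2). lia. }
  destruct (geodesic_walk (endp u p1) (endp (endp u p1) p2)) as [q [Wq [Eq Lq]]].
  destruct (walk_rev _ _ Wq) as [q' [Wq' [Eq' [Lq' [_ Iq']]]]]. rewrite Eq in *.
  exists (endp u p1), (p2 ++ q'), (p1 ++ q ++ p3), (b - a)%nat, (length q).
  rewrite !walk_app, !endp_app, !length_app, Eq, Eq'.
  do 8 (split; [tauto || lia|]). intros f g.
  rewrite El, !integral_app, Eq, Iq'. ring.
Qed.

(** * Quadratic bounds for line integrals along loops *)

Definition lipschitz (f : G -> R) : Prop := forall u v, edge u v -> Rabs (f v - f u) <= 2.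

Definition integral_bound (e C : R) : Prop :=
  forall f g, lipschitz f -> lipschitz g ->
  forall u l, walk u l -> endp u l = u ->
    Rabs (integral f g u l) <= e * INR (length l) ^ 2 + C.

(** On a loop of length [n] the total increment of [f] is 0, so [g] may be replaced by [g - g u],
    which is at most [2 n] in absolute value; each of the [n] steps then contributes at most
    [8 n]. *)
Lemma integral_bound_trivial : integral_bound 8 0.
Proof.
  intros f g Hf Hg u l Hl He.
  (* [M] bounds [g - g u] on all of the remaining walk, so the induction can start at any vertex
     [v]. *)
  assert (H : forall v p (M : R), walk v p ->
    Rabs (g v - g u) + 2 * INR (length p) <= M ->
    Rabs (integral f g v p - 2 * g u * (f (endp v p) - f v)) <= 4 * M * INR (length p)).
  { intros v p M. revert v; induction p as [|w p IH]; intros v Hp HM.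
    - simpl. replace (0 - _) with 0 by ring. rewrite Rabs_R0. lra.
    - destruct Hp as [Hvw Hp]. cbn [integral length endp] in *. rewrite S_INR in *.
      specialize (Hf _ _ Hvw). specialize (Hg _ _ Hvw).
      assert (Hw : Rabs (g w - g u) <= Rabs (g v - g u) + 2).
      { replace (g w - g u) with ((g v - g u) + (g w - g v)) by ring.
        eapply Rle_trans; [apply Rabs_triang | lra]. }
      specialize (IH w Hp ltac:(lra)).
      replace (_ - _) with (((g v - g u) + (g w - g u)) * (f w - f v)
        + (integral f g w p - 2 * g u * (f (endp w p) - f w))) by ring.
      eapply Rle_trans; [apply Rabs_triang|]. rewrite Rabs_mult.
      generalize (Rabs_triang (g v - g u) (g w - g u)), (pos_INR (length p)),
        (Rabs_pos (f w - f v)), (Rabs_pos (g v - g u + (g w - g u))). nra. }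
  specialize (H u l (2 * INR (length l)) Hl).
  rewrite He in H. rewrite !Rminus_diag, Rabs_R0, Rmult_0_r, Rminus_0_r in H.
  specialize (H ltac:(lra)). lra.
Qed.

Section Linear_chords.
Context (K : R).
Hypothesis HK : forall n, (1 <= n)%nat -> INR (DeltaS G S n) <= INR n / 6 + K.

(* A chord cutting off between a third and two thirds of the length n leaves
   loops of lengths p, q with p^2 + q^2 <= (34/36) n^2 + O(n). *)
Lemma integral_bound_contract e C : 0 <= e -> 0 <= C -> integral_bound e C ->
  exists C', 0 <= C' /\ integral_bound (35 / 36 * e) C'.
Proof.
  intros He HC HB. set (K1 := Rabs K + 1).
  assert (HK1 : 1 <= K1 /\ K + 1 <= K1)
    by (unfold K1; generalize (Rabs_pos K), (Rle_abs K); lra).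
  (* The term [2 * C] comes from the two smaller loops, [9 * e] from loops of length at most 3,
     which are not cut. *)
  exists (66 * e * K1 ^ 2 + 2 * C + 9 * e). split; [nra|].
  intros f g Hf Hg u l Hl Hu. set (n := INR (length l)).
  assert (Hn0 : 0 <= n) by apply pos_INR.
  destruct (le_lt_dec 4 (length l)) as [H4|H4].
  - destruct (split_closed_walk u l Hl Hu H4)
      as [v [l1 [l2 [m [k [Hk [Hm [W1 [E1 [L1 [W2 [E2 [L2 HI]]]]]]]]]]]]].
    rewrite HI. eapply Rle_trans; [apply Rabs_triang|].
    generalize (HB f g Hf Hg _ _ W1 E1), (HB f g Hf Hg _ _ W2 E2).
    rewrite L1, L2, !plus_INR, minus_INR by lia. fold n.
    generalize (HK (length l) ltac:(lia)). fold n.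
    assert (Hk' : INR k <= INR (DeltaS G S (length l)) + 1) by (rewrite <- S_INR; now apply le_INR).
    assert (Hm' : n <= 3 * INR m <= 2 * n).
    { unfold n. replace 3 with (INR 3) by (simpl; lra). replace 2 with (INR 2) by reflexivity.
      rewrite <- !mult_INR. split; apply le_INR; lia. }
    intros HD I1 I2. pose proof (pos_INR k) as Hk0.
    assert (Hk1 : INR k <= n / 6 + K1) by lra.
    set (x := INR m) in *. set (y := INR k) in *.
    assert (Ha : (x + y) ^ 2 <= (x + (n / 6 + K1)) ^ 2) by nra.
    assert (Hb : (n - x + y) ^ 2 <= (n - x + (n / 6 + K1)) ^ 2) by nra.
    assert (Hab : (x + (n / 6 + K1)) ^ 2 + (n - x + (n / 6 + K1)) ^ 2
      <= 35 / 36 * n ^ 2 + 66 * K1 ^ 2).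
    (* The sum of squares is convex in [x], hence largest at the ends [n / 3] and [2 n / 3]. The
       square below absorbs the linear term [8/3 n K1] at a cost of [n^2 / 36 + 64 K1^2]. *)
    { assert (0 <= (x - n / 3) * (2 * n / 3 - x)) by nra.
      generalize (pow2_ge_0 (n / 6 - 8 * K1)). nra. }
    assert (e * ((x + y) ^ 2 + (n - x + y) ^ 2) <= e * (35 / 36 * n ^ 2 + 66 * K1 ^ 2))
      by (apply Rmult_le_compat_l; lra).
    nra.
  - eapply Rle_trans; [now apply HB|]. fold n.
    assert (n <= 3) by (unfold n; replace 3 with (INR 3) by (simpl; lra); apply le_INR; lia).
    assert (n ^ 2 <= 9) by nra. nra.
Qed.

Lemma integral_bound_subquadratic k :
  exists C, 0 <= C /\ integral_bound (8 * (35 / 36) ^ k) C.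
Proof.
  induction k as [|k [C [HC IH]]].
  - exists 0. split; [lra|]. rewrite pow_O, Rmult_1_r. apply integral_bound_trivial.
  - destruct (integral_bound_contract (8 * (35 / 36) ^ k) C) as [C' [HC' H]]; auto.
    { assert (0 <= (35 / 36) ^ k) by (apply pow_le; lra). lra. }
    exists C'. split; auto. simpl. replace (8 * _) with (35 / 36 * (8 * (35 / 36) ^ k)) by ring.
    exact H.
Qed.

End Linear_chords.
(** * Loops around a point of a fat triangle *)

Lemma integral_const_l f g a u l : (forall w, In w (u :: l) -> f w = a) -> integral f g u l = 0.
Proof.
  revert u; induction l as [|v l IH]; intros u H; simpl; [reflexivity|].
  rewrite IH, (H u), (H v); [ring | simpl; auto | simpl; auto |].
  intros; apply H; now right.
Qed.

Lemma integral_const_r f g b u l : (forall w, In w (u :: l) -> g w = b) ->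
  integral f g u l = 2 * b * (f (endp u l) - f u).
Proof.
  revert u; induction l as [|v l IH]; intros u H; simpl; [ring|].
  rewrite IH, (H u), (H v); [ring | simpl; auto | simpl; auto |].
  intros; apply H; now right.
Qed.

(** Distances are doubled to match indices that count half-units, whence the constant 2 in
    [lipschitz]. Clamping freezes the function near [x] and far from it. *)
Definition clamp_dist (lo hi : nat) (x w : G) : R :=
  INR (Nat.max lo (Nat.min hi (2 * d x w))).

Lemma clamp_dist_lipschitz lo hi x : lipschitz (clamp_dist lo hi x).
Proof.
  intros u v Huv. unfold clamp_dist.
  generalize (wdist_edge _ _ Huv), (wdist_edge _ _ (edge_sym _ _ Huv)),
    (wdist_triangle x u v), (wdist_triangle x v u).
  intros H1 H2 H3 H4. apply Rabs_le.
  set (a := Nat.max lo (Nat.min hi (2 * d x v))).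
  set (b := Nat.max lo (Nat.min hi (2 * d x u))).
  assert (Hab : (a <= b + 2)%nat) by (unfold a, b; lia).
  assert (Hba : (b <= a + 2)%nat) by (unfold a, b; lia).
  apply le_INR in Hab, Hba. rewrite plus_INR in Hab, Hba. simpl (INR 2) in *. lra.
Qed.

(* Indices count half-units of length: real geodesics get sampled at
   half-integers, so that vertices nearest to consecutive samples are at
   distance at most 1. *)
Definition coarse (P : nat -> G) (N : nat) : Prop :=
  (forall i, (i < N)%nat -> (d (P i) (P (Datatypes.S i)) <= 1)%nat) /\
  forall i j, (i <= j <= N)%nat ->
    (j - i <= 2 * d (P i) (P j) + 3 /\ 2 * d (P i) (P j) <= (j - i) + 3)%nat.

(* f is the clamped distance from the centre A p and g the clamped distance
   from the start A i.  Along the loop f is constant except on the two parts of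
   A at medium distance from A p, where g takes two different constant values. *)
Lemma detour_integral A N i p j rho q : coarse A N ->
  (i <= p <= j)%nat -> (j <= N)%nat -> (4 <= rho)%nat ->
  walk (A j) q -> endp (A j) q = A i ->
  (forall w, In w (A j :: q) -> (rho <= d (A p) w)%nat) ->
  exists f g l, lipschitz f /\ lipschitz g /\ walk (A i) l /\ endp (A i) l = A i /\
    (length l <= (j - i) + length q)%nat /\
    integral f g (A i) l = 4 * (INR rho - 3) ^ 2.
Proof.
  intros [Hs Hc] Hp Hj Hr Hq Eq Hf.
  assert (Hi' : (rho <= d (A i) (A p))%nat) by (rewrite wdist_sym, <- Eq; apply Hf, endp_in).
  assert (Hj' : (rho <= d (A p) (A j))%nat) by (apply Hf; now left).
  destruct (Hc i p ltac:(lia)) as [_ Hip]. destruct (Hc p j ltac:(lia)) as [_ Hpj].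
  destruct (lazy_segment_walk A i (p - rho)) as [l1 [W1 [E1 [L1 M1]]]]; [lia | intros; apply Hs; lia|].
  destruct (lazy_segment_walk A (p - rho) (p + rho)) as [l2 [W2 [E2 [L2 M2]]]]; [lia | intros; apply Hs; lia|].
  destruct (lazy_segment_walk A (p + rho) j) as [l3 [W3 [E3 [L3 M3]]]]; [lia | intros; apply Hs; lia|].
  (* By [coarse], twice the distance from [A i] is at most [glo] for indices from [i] to [p - rho]
     and at least [ghi] from [p + rho] to [j], so [g] is constant on each of these parts. *)
  set (glo := (p - rho - i + 3)%nat). set (ghi := (p + rho - i - 3)%nat).
  set (f := clamp_dist (rho + 3) (2 * rho) (A p)). set (g := clamp_dist glo ghi (A i)).
  exists f, g, (l1 ++ l2 ++ l3 ++ q).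
  split; [apply clamp_dist_lipschitz|]. split; [apply clamp_dist_lipschitz|].
  rewrite !walk_app, !endp_app, !length_app, !integral_app, E1, E2, E3.
  do 3 (split; [tauto || lia|]).
  assert (F2 : forall k, (p - rho <= k <= p + rho)%nat -> f (A k) = INR (rho + 3)).
  { intros k Hk. unfold f, clamp_dist. f_equal.
    assert (2 * d (A p) (A k) <= rho + 3)%nat; [|lia].
    destruct (le_lt_dec p k).
    - destruct (Hc p k ltac:(lia)). lia.
    - rewrite wdist_sym. destruct (Hc k p ltac:(lia)). lia. }
  assert (Ff : forall w, In w (A j :: q) -> f w = INR (2 * rho)).
  { intros w Hw. unfold f, clamp_dist. f_equal. specialize (Hf w Hw). lia. }
  assert (Fi : f (A i) = INR (2 * rho)) by (rewrite <- Eq; apply Ff, endp_in).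
  assert (Fj : f (A j) = INR (2 * rho)) by (apply Ff; now left).
  rewrite (integral_const_r f g (INR glo) _ l1), (integral_const_l f g (INR (rho + 3)) _ l2),
    (integral_const_r f g (INR ghi) _ l3), (integral_const_l f g (INR (2 * rho)) _ q), ?E1, ?E3, Fi, Fj,
    !F2; try lia; auto; try (intros w Hw).
  (* Only [l1] and [l3] contribute: [f] falls by [rho - 3] where [g] is [glo], rises by as much
     where [g] is [ghi], and [ghi - glo] is [2 * rho - 6]. *)
  - unfold glo, ghi. rewrite (plus_INR _ 3), (minus_INR _ i), !minus_INR, !plus_INR, mult_INR by lia.
    simpl (INR 2). simpl (INR 3). ring.
  - destruct (M3 w Hw) as [k [Hk ->]]. unfold g, clamp_dist. f_equal.
    destruct (Hc i k ltac:(lia)). unfold glo, ghi in *. lia.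
  - destruct (M2 w Hw) as [k [Hk ->]]. auto.
  - destruct (M1 w Hw) as [k [Hk ->]]. unfold g, clamp_dist. f_equal.
    destruct (Hc i k ltac:(lia)). unfold glo, ghi in *. lia.
Qed.

(** * Short walks outside a ball *)

Definition avoiding (x : G) (rho n : nat) (u v : G) : Prop :=
  exists l, walk u l /\ endp u l = v /\ (length l <= n)%nat /\
    forall w, In w (u :: l) -> (rho <= d x w)%nat.

Lemma avoiding_sym x rho n u v : avoiding x rho n u v -> avoiding x rho n v u.
Proof.
  intros [l [H1 [<- [H3 H4]]]]. destruct (walk_rev u l H1) as [l' [W [E [L [M _]]]]].
  exists l'. repeat split; auto. lia.
Qed.

Lemma avoiding_trans x rho m n u v w :
  avoiding x rho m u v -> avoiding x rho n v w -> avoiding x rho (m + n) u w.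
Proof.
  intros [l [H1 [<- [H3 H4]]]] [l' [K1 [<- [K3 K4]]]]. exists (l ++ l').
  rewrite walk_app, endp_app, length_app. repeat split; auto; [lia|].
  intros a Ha. rewrite app_comm_cons in Ha. apply in_app_or in Ha.
  destruct Ha; [now apply H4 | apply K4; now right].
Qed.

Lemma avoiding_wdist x rho n u v : avoiding x rho n u v -> (d u v <= n)%nat.
Proof. intros [l [H1 [<- [H3 _]]]]. generalize (wdist_walk u l H1). lia. Qed.

Lemma avoiding_near x rho n u v :
  (d u v <= n)%nat -> (rho + n <= d x v)%nat -> avoiding x rho n u v.
Proof.
  intros H1 H2. destruct (geodesic_walk u v) as [l [Hl [He Hn]]].
  exists l. repeat split; auto; [lia|].
  intros w Hw. generalize (walk_wdist_mem u l w Hl Hw), (wdist_triangle x w v). rewrite He. lia.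
Qed.

(** The walk follows the side itself, on which the index difference is at most twice the distance
    plus 3. *)
Lemma avoiding_side x rho n P N a b : coarse P N ->
  (forall k, (k <= N)%nat -> (rho <= d x (P k))%nat) ->
  (a <= N)%nat -> (b <= N)%nat -> (2 * d (P a) (P b) + 3 <= n)%nat ->
  avoiding x rho n (P a) (P b).
Proof.
  intros [Hs Hc] Hx.
  assert (H : forall a b, (a <= b <= N)%nat -> (2 * d (P a) (P b) + 3 <= n)%nat ->
    avoiding x rho n (P a) (P b)).
  { clear a b; intros a b Hab Hn.
    destruct (lazy_segment_walk P a b) as [l [W [E [L M]]]]; [lia | intros; apply Hs; lia|].
    destruct (Hc a b Hab). exists l. repeat split; auto; [lia|].
    intros w Hw. destruct (M w Hw) as [k [Hk ->]]. apply Hx. lia. }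
  intros Ha Hb Hn. destruct (le_lt_dec a b).
  - apply H; auto.
  - apply avoiding_sym, H; [lia|]. now rewrite wdist_sym.
Qed.

(* Decreasing indices on the side D are supposed to advance along A. *)
Lemma detour_aux A NA D ND O NO r p i j a z :
  (2 <= r)%nat -> coarse A NA -> coarse D ND -> coarse O NO ->
  (forall k, (k <= ND)%nat -> (r <= d (A p) (D k))%nat) ->
  (forall k, (k <= NO)%nat -> (r <= d (A p) (O k))%nat) ->
  (forall k, (k <= ND)%nat -> (exists m, (m <= NA)%nat /\ (d (D k) (A m) <= r)%nat) \/
                              (exists o, (o <= NO)%nat /\ (d (D k) (O o) <= r)%nat)) ->
  (d (D 0%nat) (A NA) <= 2)%nat \/
    (exists o, (o <= NO)%nat /\ (d (D 0%nat) (O o) <= 2)%nat) ->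
  (forall i m a b, (i <= NA)%nat -> (m <= NA)%nat -> (b <= a <= ND)%nat ->
     (d (A i) (D a) <= r + 2)%nat -> (d (A m) (D b) <= r + 2)%nat ->
     (i + (a - b) <= m + 4 * r + 40)%nat) ->
  (i <= p <= j)%nat -> (j <= NA)%nat -> (p - i <= 8 * r)%nat -> (j - p <= 8 * r)%nat ->
  (a <= ND)%nat -> avoiding (A p) (r - 2) (r + 2) (A i) (D a) ->
  avoiding (A p) (r - 2) (r + 2) (A j) z ->
  (exists k, (k <= ND)%nat /\ z = D k) \/ (exists k, (k <= NO)%nat /\ z = O k) ->
  exists m n, (p <= m <= NA)%nat /\ (m - i + n <= 100 * r + 100)%nat /\
    avoiding (A p) (r - 2) n (A m) (A i).
Proof.
  intros Hr CA CD CO XD XO cov Hend Hor Hp Hj Hpi Hjp Ha Wi Wj Hz.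
  assert (XD' : forall k, (k <= ND)%nat -> (r - 2 <= d (A p) (D k))%nat)
    by (intros k Hk; generalize (XD k Hk); lia).
  assert (XO' : forall k, (k <= NO)%nat -> (r - 2 <= d (A p) (O k))%nat)
    by (intros k Hk; generalize (XO k Hk); lia).
  pose proof (avoiding_wdist _ _ _ _ _ Wi) as Di.
  pose proof (avoiding_wdist _ _ _ _ _ Wj) as Dj.
  destruct (proj2 CA i j ltac:(lia)) as [_ Dij].
  pose proof (wdist_sym (A i) (D a)) as Si. pose proof (wdist_sym (A j) z) as Sj.
  pose proof (wdist_sym (A i) (A j)) as Sij.
  pose proof (wdist_triangle z (A j) (A i)). pose proof (wdist_triangle z (A i) (D a)).
  (* If [A j] is joined to [D], the return runs along [D] from [D k] to [D a], which are close
     because [A i] and [A j] are. *)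
  destruct Hz as [[k [Hk ->]]|[k [Hk ->]]].
  { exists j, ((r + 2) + ((20 * r + 14) + (r + 2)))%nat.
    split; [lia|]. split; [lia|].
    apply avoiding_trans with (D k); auto.
    apply avoiding_trans with (D a); [|now apply avoiding_sym].
    apply avoiding_side with ND; auto. lia. }
  (* Now [A j] is joined to [O]. Moving back this far along [D] puts [D b] so far from [A p] that a
     link of length [r] from it misses the ball, and by [Hor] any [A m] near [D b] has [m] beyond
     [p]. *)
  set (b := (a - (20 * r + 30))%nat).
  assert (Hb : (b <= a)%nat) by (unfold b; lia).
  destruct (proj2 CD b a ltac:(lia)) as [Eba Dba]. pose proof (wdist_sym (D b) (D a)) as Sba.
  assert (Wba : avoiding (A p) (r - 2) (20 * r + 36) (D b) (D a)).
  { apply avoiding_side with ND; auto; [lia|]. lia. }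
  destruct (proj2 CA i p ltac:(lia)) as [_ Dip].
  pose proof (wdist_triangle (D b) (A p) (D a)). pose proof (wdist_triangle (A p) (A i) (D a)).
  pose proof (wdist_sym (A p) (A i)). pose proof (wdist_sym (A p) (D b)).
  assert (Hq : (exists m, (p <= m <= NA)%nat /\ (d (D b) (A m) <= r + 2)%nat /\
                 avoiding (A p) (r - 2) (r + 2) (A m) (D b)) \/
               (exists o, (o <= NO)%nat /\ (d (D b) (O o) <= r + 2)%nat /\
                 avoiding (A p) (r - 2) (r + 2) (O o) (D b))).
  { destruct (Nat.le_gt_cases (20 * r + 30) a) as [Hcl|Hcl].
    - destruct (cov b ltac:(lia)) as [[m [Hm Dm]]|[o [Ho Do]]].
      + left. exists m. rewrite wdist_sym in Dm.
        generalize (Hor i m a b ltac:(lia) Hm ltac:(lia) Di ltac:(lia)). intro Him.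
        split; [lia|]. split; [rewrite wdist_sym; lia|].
        apply avoiding_near; lia.
      + right. exists o. rewrite wdist_sym in Do.
        split; [lia|]. split; [rewrite wdist_sym; lia|].
        apply avoiding_near; lia.
    (* The subtraction was truncated: [D] ends too early, and the corner at [D 0] takes the place of
       the covering. *)
    - replace b with 0%nat by lia.
      assert (Hnear : forall u, (d (D 0%nat) u <= 2)%nat -> avoiding (A p) (r - 2) (r + 2) u (D 0%nat)).
      { intros u Hu. destruct (avoiding_near (A p) (r - 2) 2 u (D 0%nat)) as [l [L1 [L2 [L3 L4]]]].
        - now rewrite wdist_sym.
        - generalize (XD 0%nat ltac:(lia)). lia.
        - exists l. repeat split; auto. lia. }
      destruct Hend as [He0|[o [Ho He0]]].
      + left. exists NA. split; [lia|]. split; [lia | auto].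
      + right. exists o. split; [lia|]. split; [lia | auto]. }
  destruct Hq as [[m [Hm [Dm Wm]]]|[o [Ho [Do Wo]]]].
  - exists m, ((r + 2) + ((20 * r + 36) + (r + 2)))%nat.
    destruct (proj2 CA i m ltac:(lia)) as [Eim _].
    pose proof (wdist_triangle (A i) (D a) (A m)). pose proof (wdist_triangle (D a) (D b) (A m)).
    split; [lia|]. split; [lia|].
    apply avoiding_trans with (D b); auto.
    apply avoiding_trans with (D a); auto. now apply avoiding_sym.
  (* The summands are the legs of the route [A j], [O k], [O o], [D b], [D a], [A i]. *)
  - exists j, ((r + 2) + ((42 * r + 60) + ((r + 2) + ((20 * r + 36) + (r + 2)))))%nat.
    split; [lia|]. split; [lia|].
    apply avoiding_trans with (O k); auto.
    apply avoiding_trans with (O o).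
    { apply avoiding_side with NO; auto.
      pose proof (wdist_triangle (O k) (D a) (O o)). pose proof (wdist_triangle (D a) (D b) (O o)).
      lia. }
    apply avoiding_trans with (D b); auto.
    apply avoiding_trans with (D a); auto. now apply avoiding_sym.
Qed.

(** * Slimness of coarse triangles *)

Definition near (r : nat) (x : G) (P : nat -> G) (N : nat) : Prop :=
  exists k, (k <= N)%nat /\ (d x (P k) <= r)%nat.

Definition covered (r : nat) A NA B NB C NC : Prop :=
  forall k, (k <= NA)%nat -> near r (A k) B NB \/ near r (A k) C NC.

Definition slim (r : nat) A NA B NB C NC : Prop :=
  covered r A NA B NB C NC /\ covered r B NB C NC A NA /\ covered r C NC A NA B NB.

(** The corners are allowed gaps of 2 because each sampled side ends within 1 of the vertex chosen
    for the corner. *)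
Definition triangle A NA B NB C NC : Prop :=
  (coarse A NA /\ coarse B NB /\ coarse C NC) /\
  (d (A NA) (B 0%nat) <= 2 /\ d (B NB) (C 0%nat) <= 2 /\ d (C NC) (A 0%nat) <= 2)%nat.

Lemma triangle_rotate A NA B NB C NC :
  triangle A NA B NB C NC -> triangle B NB C NC A NA.
Proof. unfold triangle. tauto. Qed.

(** On either side of [p], at index distance [8 * r] or at the end of [A] if that is nearer,
    slimness or the corner gives a short link to [B] or [C] that misses the ball. The side linked to
    [A i] plays the role of [D] in [detour_aux]. *)
Lemma triangle_detour r A NA B NB C NC p : (10 <= r)%nat ->
  triangle A NA B NB C NC -> slim r A NA B NB C NC -> (p <= NA)%nat ->
  (forall k, (k <= NB)%nat -> (r <= d (A p) (B k))%nat) ->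
  (forall k, (k <= NC)%nat -> (r <= d (A p) (C k))%nat) ->
  exists i j n, (i <= p <= j)%nat /\ (j <= NA)%nat /\ (j - i + n <= 100 * r + 100)%nat /\
    avoiding (A p) (r - 2) n (A j) (A i).
Proof.
  intros Hr [[CA [CB CC]] [AB [BC CA']]] [covA [covB covC]] Hp XB XC.
  assert (Hgap : forall u v, (d u v <= 2)%nat -> (r <= d (A p) v)%nat ->
    avoiding (A p) (r - 2) (r + 2) u v).
  { intros u v H1 H2. destruct (avoiding_near (A p) (r - 2) 2 u v) as [l [L1 [L2 [L3 L4]]]]; auto; [lia|].
    exists l. repeat split; auto. lia. }
  assert (Hnear : forall i P N, near r (A i) P N -> (2 * r <= d (A p) (A i))%nat ->
    exists k, (k <= N)%nat /\ avoiding (A p) (r - 2) (r + 2) (A i) (P k)).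
  { intros i P N [k [Hk Dk]] Hi. exists k. split; auto.
    apply avoiding_sym, avoiding_near; [rewrite wdist_sym|]; lia. }
  assert (HL : exists i, (i <= p)%nat /\ (p - i <= 8 * r)%nat /\
    ((exists k, (k <= NB)%nat /\ avoiding (A p) (r - 2) (r + 2) (A i) (B k)) \/
     (exists k, (k <= NC)%nat /\ avoiding (A p) (r - 2) (r + 2) (A i) (C k)))).
  { destruct (le_lt_dec (8 * r) p) as [Hc|Hc].
    - exists (p - 8 * r)%nat. split; [lia|]. split; [lia|].
      destruct (proj2 CA (p - 8 * r)%nat p ltac:(lia)) as [H _]. rewrite wdist_sym in H.
      destruct (covA (p - 8 * r)%nat ltac:(lia)) as [H'|H'];
        [left | right]; apply Hnear; auto; lia.
    - exists 0%nat. split; [lia|]. split; [lia|]. right. exists NC. split; [lia|].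
      apply Hgap; [now rewrite wdist_sym | now apply XC]. }
  assert (HR : exists j, (p <= j <= NA)%nat /\ (j - p <= 8 * r)%nat /\
    ((exists k, (k <= NB)%nat /\ avoiding (A p) (r - 2) (r + 2) (A j) (B k)) \/
     (exists k, (k <= NC)%nat /\ avoiding (A p) (r - 2) (r + 2) (A j) (C k)))).
  { destruct (le_lt_dec (p + 8 * r) NA) as [Hc|Hc].
    - exists (p + 8 * r)%nat. split; [lia|]. split; [lia|].
      destruct (proj2 CA p (p + 8 * r)%nat ltac:(lia)) as [H _].
      destruct (covA (p + 8 * r)%nat ltac:(lia)) as [H'|H'];
        [left | right]; apply Hnear; auto; lia.
    - exists NA. split; [lia|]. split; [lia|]. left. exists 0%nat. split; [lia|].
      apply Hgap; [auto | apply XB; lia]. }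
  destruct HL as [i [Hi [Hi' HL]]]. destruct HR as [j [Hj [Hj' HR]]].
  assert (Hz : exists z, avoiding (A p) (r - 2) (r + 2) (A j) z /\
    ((exists k, (k <= NB)%nat /\ z = B k) \/ (exists k, (k <= NC)%nat /\ z = C k))).
  { destruct HR as [[k [Hk W]]|[k [Hk W]]]; [exists (B k) | exists (C k)]; split; eauto. }
  destruct Hz as [z [Wz Hz]].
  assert (Hm : exists m n, (p <= m <= NA)%nat /\ (m - i + n <= 100 * r + 100)%nat /\
    avoiding (A p) (r - 2) n (A m) (A i)).
  { destruct HL as [[a [Ha W]]|[a [Ha W]]].
    - apply (detour_aux A NA B NB C NC r p i j a z); auto; try lia.
      + intros k Hk. destruct (covB k Hk); auto.
      + left. now rewrite wdist_sym.
      (* [B] starts where [A] ends. Comparing distances to this corner shows that [i + a] and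
         [m + b] both equal [NA] up to [2 * r + 14]. *)
      + clear - CA CB AB HS. intros i m a b Hi Hm Hab D1 D2.
        destruct (proj2 CA i NA ltac:(lia)), (proj2 CA m NA ltac:(lia)).
        destruct (proj2 CB 0%nat a ltac:(lia)), (proj2 CB 0%nat b ltac:(lia)).
        pose proof (wdist_triangle (A m) (B b) (A NA)).
        pose proof (wdist_triangle (B b) (B 0%nat) (A NA)).
        pose proof (wdist_triangle (B 0%nat) (A NA) (B a)).
        pose proof (wdist_triangle (A NA) (A i) (B a)).
        pose proof (wdist_sym (B 0%nat) (A NA)). pose proof (wdist_sym (A NA) (A i)).
        pose proof (wdist_sym (B b) (B 0%nat)).
        lia.
    - apply (detour_aux A NA C NC B NB r p i j a z); auto; try lia.
      + right. exists NB. split; [lia|]. now rewrite wdist_sym.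
      (* [C] ends where [A] starts, so the same comparison is made with [NC]. *)
      + clear - CA CC CA' HS. intros i m a b Hi Hm Hab D1 D2.
        destruct (proj2 CA 0%nat i ltac:(lia)), (proj2 CA 0%nat m ltac:(lia)).
        destruct (proj2 CC a NC ltac:(lia)), (proj2 CC b NC ltac:(lia)).
        pose proof (wdist_triangle (C b) (A m) (C NC)).
        pose proof (wdist_triangle (A m) (A 0%nat) (C NC)).
        pose proof (wdist_triangle (A 0%nat) (C NC) (A i)).
        pose proof (wdist_triangle (C NC) (C a) (A i)).
        pose proof (wdist_sym (A m) (A 0%nat)). pose proof (wdist_sym (A 0%nat) (C NC)).
        pose proof (wdist_sym (C NC) (C a)). pose proof (wdist_sym (C b) (A m)).
        pose proof (wdist_sym (C a) (A i)).
        lia.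
      + tauto. }
  destruct Hm as [m [n [Hm [Hn W]]]]. exists i, m, n. split; [lia|]. split; [lia|]. auto.
Qed.
Lemma coarse_covered A NA P N : coarse A NA -> forall k, (k <= NA)%nat ->
  near (NA + 3 + d (A 0%nat) (P 0%nat)) (A k) P N.
Proof.
  intros [_ H] k Hk. exists 0%nat. split; [lia|].
  destruct (H 0%nat k ltac:(lia)).
  generalize (wdist_triangle (A k) (A 0%nat) (P 0%nat)), (wdist_sym (A k) (A 0%nat)). lia.
Qed.

Lemma near_mono r r' x P N : (r <= r')%nat -> near r x P N -> near r' x P N.
Proof. intros Hr [k [Hk H]]. exists k. split; lia. Qed.

Lemma slim_mono r r' A NA B NB C NC : (r <= r')%nat ->
  slim r A NA B NB C NC -> slim r' A NA B NB C NC.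
Proof.
  intros Hr [H1 [H2 H3]].
  split; [|split]; intros k Hk;
    [destruct (H1 k Hk) | destruct (H2 k Hk) | destruct (H3 k Hk)];
    [left | right | left | right | left | right]; now apply (near_mono r).
Qed.

(** A crude bound, whose only purpose is that a least slimness constant exists. *)
Lemma slim_exists A NA B NB C NC : triangle A NA B NB C NC ->
  exists r, slim r A NA B NB C NC.
Proof.
  intros [[CA [CB CC]] _].
  exists (NA + NB + NC + 3 + d (A 0%nat) (B 0%nat) + d (B 0%nat) (C 0%nat) + d (C 0%nat) (A 0%nat))%nat.
  split; [|split]; intros k Hk; left;
    (eapply near_mono; [|apply coarse_covered]); eauto; lia.
Qed.

Lemma not_covered r A NA B NB C NC : ~ covered r A NA B NB C NC ->
  exists p, (p <= NA)%nat /\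
    (forall k, (k <= NB)%nat -> (Datatypes.S r <= d (A p) (B k))%nat) /\
    (forall k, (k <= NC)%nat -> (Datatypes.S r <= d (A p) (C k))%nat).
Proof.
  intro H. apply not_all_ex_not in H. destruct H as [p H].
  apply imply_to_and in H. destruct H as [Hp H]. apply not_or_and in H. destruct H as [H1 H2].
  exists p. repeat split; auto; intros k Hk; apply Nat.nle_gt; intro Hd;
    [apply H1 | apply H2]; now exists k.
Qed.

(** Let [r] be the least constant for one triangle. If [r] is large, a point at distance at least
    [r] from the other two sides would give a loop whose integral is too large; so [r - 1] works for
    each side in turn, against minimality. *)
Lemma slim_of_linear_chords (K : R) :
  (forall n, (1 <= n)%nat -> INR (DeltaS G S n) <= INR n / 6 + K) ->
  exists r0, forall A NA B NB C NC, triangle A NA B NB C NC -> slim r0 A NA B NB C NC.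
Proof.
  intro HK.
  (* The loop has length at most [100 (r + 1)], and 80000 is [8 * 100^2]; the bound becomes
     [(r + 1)^2 + C0], against an integral of [4 (r - 5)^2]. *)
  destruct (pow_lt_1_zero (35 / 36)) with (y := / 80000) as [k Hk];
    [rewrite Rabs_pos_eq; lra | lra |].
  specialize (Hk k (le_n k)). rewrite Rabs_pos_eq in Hk by (apply pow_le; lra).
  destruct (integral_bound_subquadratic K HK k) as [C0 [HC0 HB]].
  destruct (INR_unbounded C0) as [r1 Hr1].
  assert (Hcore : forall r, (20 + r1 < r)%nat -> forall A NA B NB C NC, triangle A NA B NB C NC -> slim r A NA B NB C NC ->
    covered (r - 1) A NA B NB C NC).
  { intros r Hr A NA B NB C NC HT Hs.
    apply NNPP. intro Hn. destruct (not_covered _ _ _ _ _ _ _ Hn) as [p [Hp [HB' HC']]].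
    replace (Datatypes.S (r - 1)) with r in * by lia.
    destruct (triangle_detour r A NA B NB C NC p ltac:(lia) HT Hs Hp HB' HC')
      as [i [j [n [Hi [Hj [Hl [q [Wq [Eq [Lq Mq]]]]]]]]]].
    destruct (detour_integral A NA i p j (r - 2) q (proj1 (proj1 HT)) Hi Hj ltac:(lia) Wq Eq Mq)
      as [f [g [l [Hf [Hg [Wl [El [Ll HI]]]]]]]].
    generalize (HB f g Hf Hg _ _ Wl El). rewrite HI.
    assert (Hl' : INR (length l) <= 100 * INR r + 100).
    { replace 100 with (INR 100) by (rewrite INR_IZR_INZ; reflexivity).
      rewrite <- mult_INR, <- plus_INR. apply le_INR. lia. }
    assert (Hr' : 20 + C0 < INR r).
    { apply lt_INR in Hr. rewrite plus_INR in Hr.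
      replace 20 with (INR 20) by (rewrite INR_IZR_INZ; reflexivity). lra. }
    rewrite minus_INR by lia. simpl (INR 2).
    set (x := INR r) in *. set (y := INR (length l)) in *.
    assert (Hy : 0 <= y) by apply pos_INR.
    assert (Hy2 : y ^ 2 <= 10000 * (x + 1) ^ 2) by nra.
    assert (H8 : 8 * (35 / 36) ^ k * y ^ 2 <= (x + 1) ^ 2).
    { set (e := (35 / 36) ^ k) in *. assert (0 <= e) by (apply pow_le; lra). nra. }
    intro Hfin. rewrite Rabs_pos_eq in Hfin by nra. nra. }
  exists (20 + r1)%nat. intros A NA B NB C NC HT.
  destruct (least_spec _ (slim_exists _ _ _ _ _ _ HT)) as [Hs Hmin].
  set (r := least _) in *.
  destruct (le_lt_dec r (20 + r1)) as [Hr|Hr]; [now apply (slim_mono r)|]. exfalso.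
  enough (H : slim (r - 1) A NA B NB C NC) by (specialize (Hmin _ H); lia).
  destruct Hs as [H1 [H2 H3]].
  pose proof (triangle_rotate _ _ _ _ _ _ HT) as HT2.
  pose proof (triangle_rotate _ _ _ _ _ _ HT2) as HT3.
  split; [|split]; apply Hcore; auto; unfold slim; auto.
Qed.
(** * Points of the Cayley graph *)

Notation point := (point G).

Definition vtx (x : point) : G :=
  if Rle_dec (pt G x) (1 / 2) then pv G x else mul (pv G x) (ps G x).

Lemma INR_wdist_triangle u v w : INR (d u w) <= INR (d u v) + INR (d v w).
Proof. rewrite <- plus_INR. apply le_INR, wdist_triangle. Qed.

Lemma vtx_wdist x : valid G S x ->
  INR (d (vtx x) (pv G x)) <= pt G x + 1 / 2 /\
  INR (d (vtx x) (mul (pv G x) (ps G x))) <= (1 - pt G x) + 1 / 2 /\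
  INR (d (pv G x) (mul (pv G x) (ps G x))) <= 1.
Proof.
  intros [Hs Ht].
  assert (He : edge (pv G x) (mul (pv G x) (ps G x))) by now exists (ps G x).
  pose proof (le_INR _ _ (wdist_edge _ _ He)) as H1.
  pose proof (le_INR _ _ (wdist_edge _ _ (edge_sym _ _ He))) as H2. simpl (INR 1) in *.
  unfold vtx. destruct (Rle_dec _ _) as [H|H]; rewrite wdist_refl; simpl (INR 0); lra.
Qed.

(** Each point is within 1/2 of its vertex. The upper bound uses the route through the two chosen
    vertices; for the lower bound all four routes are compared with the triangle inequality. *)
Lemma gdist_vtx x y : valid G S x -> valid G S y ->
  INR (d (vtx x) (vtx y)) - 1 <= gdist G S x y <= INR (d (vtx x) (vtx y)) + 1.
Proof.
  intros Hx Hy. generalize (vtx_wdist x Hx), (vtx_wdist y Hy).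
  intros [X1 [X2 X3]] [Y1 [Y2 Y3]]. destruct Hx as [_ Hx], Hy as [_ Hy].
  assert (Hle : forall a b, INR (d (vtx x) (vtx y))
    <= INR (d (vtx x) a) + INR (d a b) + INR (d (vtx y) b)).
  { intros a b. rewrite (wdist_sym (vtx y) b).
    generalize (INR_wdist_triangle (vtx x) a (vtx y)), (INR_wdist_triangle a b (vtx y)). lra. }
  pose proof (Hle (pv G x) (pv G y)) as L1.
  pose proof (Hle (pv G x) (mul (pv G y) (ps G y))) as L2.
  pose proof (Hle (mul (pv G x) (ps G x)) (pv G y)) as L3.
  pose proof (Hle (mul (pv G x) (ps G x)) (mul (pv G y) (ps G y))) as L4.
  unfold gdist.
  set (via := Rmin (Rmin _ _) (Rmin _ _)).
  assert (Hvia : INR (d (vtx x) (vtx y)) - 1 <= via <= INR (d (vtx x) (vtx y)) + 1).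
  { unfold via. split.
    - repeat apply Rmin_glb; lra.
    - unfold vtx. destruct (Rle_dec (pt G x) _), (Rle_dec (pt G y) _).
      + eapply Rle_trans; [apply Rmin_l|]. eapply Rle_trans; [apply Rmin_l|]. lra.
      + eapply Rle_trans; [apply Rmin_l|]. eapply Rle_trans; [apply Rmin_r|]. lra.
      + eapply Rle_trans; [apply Rmin_r|]. eapply Rle_trans; [apply Rmin_l|]. lra.
      + eapply Rle_trans; [apply Rmin_r|]. eapply Rle_trans; [apply Rmin_r|]. lra. }
  destruct (excluded_middle_informative _) as [[Eg Es]|_]; [|exact Hvia].
  split; [|eapply Rle_trans; [apply Rmin_l | apply Hvia]].
  apply Rmin_glb; [apply Hvia|].
  (* For two points of one edge both vertices are ends of that edge. *)
  assert (Hd : INR (d (vtx x) (vtx y)) <= 1).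
  { unfold vtx. rewrite <- Eg, <- Es in *.
    destruct (Rle_dec (pt G x) _), (Rle_dec (pt G y) _);
      rewrite ?(wdist_sym (mul _ _) (pv G x)), ?wdist_refl; simpl (INR 0); lra. }
  generalize (Rabs_pos (pt G x - pt G y)). lra.
Qed.

Definition sample (c : R -> point) (L : R) (i : nat) : G := vtx (c (Rmin (INR i / 2) L)).

Lemma nat_ceil (x : R) : 0 <= x -> exists N, x <= INR N <= x + 1.
Proof.
  intro Hx. destruct (archimed x) as [H1 H2].
  exists (Z.to_nat (up x)). rewrite INR_IZR_INZ, Z2Nat.id; [lra|].
  apply le_IZR. lra.
Qed.

Lemma nat_floor (x : R) : 0 <= x -> exists N, INR N <= x < INR N + 1.
Proof.
  intro Hx. destruct (archimed x) as [H1 H2].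
  exists (Z.to_nat (up x - 1)). rewrite INR_IZR_INZ, Z2Nat.id.
  - rewrite minus_IZR. lra.
  - assert (0 < up x)%Z by (apply lt_IZR; lra). lia.
Qed.

(** Passing to vertices changes a distance by at most 1, and the last step, cut off at [L], may lose
    1/2; doubled, this is the slack 3 in [coarse]. Consecutive samples have vertices at distance at
    most 3/2, hence at most 1. *)
Lemma sample_coarse x y L c : valid G S x -> valid G S y -> geodesic G S x y L c ->
  exists N, 2 * L <= INR N /\ coarse (sample c L) N /\
    (d (sample c L 0) (vtx x) <= 1)%nat /\ (d (sample c L N) (vtx y) <= 1)%nat.
Proof.
  intros Hx Hy [HL [Hv [H0 [H1 Hd]]]].
  destruct (nat_ceil (2 * L) ltac:(lra)) as [N HN]. exists N.
  assert (Hlt : forall m n, INR m < INR n + 1 -> (m <= n)%nat).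
  { intros m n H. rewrite <- S_INR in H. apply INR_lt in H. lia. }
  assert (HR : forall i, 0 <= Rmin (INR i / 2) L <= L).
  { intro i. pose proof (pos_INR i). split; [apply Rmin_glb; lra | apply Rmin_r]. }
  assert (HM : forall i j, (i <= j <= N)%nat ->
    (INR j - INR i) / 2 - 1 / 2 <= Rabs (Rmin (INR i / 2) L - Rmin (INR j / 2) L)
    <= (INR j - INR i) / 2).
  { intros i j [Hij HjN]. apply le_INR in Hij, HjN.
    unfold Rmin. destruct (Rle_dec _ _), (Rle_dec _ _); rewrite Rabs_left1; lra. }
  assert (HV : forall i j, INR (d (sample c L i) (sample c L j)) - 1
    <= Rabs (Rmin (INR i / 2) L - Rmin (INR j / 2) L)
    <= INR (d (sample c L i) (sample c L j)) + 1).
  { intros i j. rewrite <- Hd by apply HR. apply gdist_vtx; apply Hv, HR. }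
  split; [lra|]. split; [split|].
  - intros i Hi. apply Hlt. generalize (HV i (Datatypes.S i)), (HM i (Datatypes.S i) ltac:(lia)).
    rewrite S_INR. simpl (INR 1). lra.
  - intros i j Hij. generalize (HV i j), (HM i j Hij).
    set (e := d (sample c L i) (sample c L j)). intros E1 E2.
    split; apply Hlt; rewrite !plus_INR, !mult_INR, minus_INR by lia; simpl (INR 2); simpl (INR 3); lra.
  - unfold sample. split; apply Hlt.
    + replace (Rmin (INR 0 / 2) L) with 0 by (rewrite Rmin_left; simpl; lra).
      generalize (gdist_vtx (c 0) x (Hv 0 ltac:(lra)) Hx). rewrite H0. simpl (INR 1). lra.
    + rewrite Rmin_right by lra.
      generalize (gdist_vtx (c L) y (Hv L ltac:(lra)) Hy). rewrite H1. simpl (INR 1). lra.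
Qed.

(** Moving to the preceding sample costs less than 1/2, and [gdist_vtx] is applied twice at a cost
    of 1 each; the total stays below 3. *)
Lemma thin_of_slim r0 :
  (forall A NA B NB C NC, triangle A NA B NB C NC -> slim r0 A NA B NB C NC) ->
  thin_triangles G S (INR r0 + 3).
Proof.
  intros Hslim x y z L1 L2 L3 c1 c2 c3 Hx Hy Hz G1 G2 G3 a Ha.
  destruct (sample_coarse _ _ _ _ Hx Hy G1) as [N1 [B1 [C1 [S1 E1]]]].
  destruct (sample_coarse _ _ _ _ Hy Hz G2) as [N2 [B2 [C2 [S2 E2]]]].
  destruct (sample_coarse _ _ _ _ Hz Hx G3) as [N3 [B3 [C3 [S3 E3]]]].
  assert (Hgap : forall u v w, (d u w <= 1)%nat -> (d v w <= 1)%nat -> (d u v <= 2)%nat)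
    by (intros u v w; rewrite (wdist_sym v w); generalize (wdist_triangle u w v); lia).
  destruct (Hslim _ N1 _ N2 _ N3 (conj (conj C1 (conj C2 C3))
    (conj (Hgap _ _ _ E1 S2) (conj (Hgap _ _ _ E2 S3) (Hgap _ _ _ E3 S1))))) as [Hcov _].
  destruct (nat_floor (2 * a) ltac:(lra)) as [i Hi].
  assert (HiN : (i <= N1)%nat) by (apply INR_le; lra).
  destruct G1 as [_ [V1 [_ [_ D1]]]].
  assert (Ei : sample c1 L1 i = vtx (c1 (INR i / 2)))
    by (unfold sample; rewrite Rmin_left; [auto | lra]).
  pose proof (pos_INR i) as Hi0.
  assert (Hgo : forall x y L c N, geodesic G S x y L c -> near r0 (sample c1 L1 i) (sample c L) N ->
    exists b, 0 <= b <= L /\ gdist G S (c1 a) (c b) <= INR r0 + 3).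
  { intros x' y' L c N [HL [V [_ [_ D]]]] [k [Hk Hd]].
    exists (Rmin (INR k / 2) L).
    assert (Hb : 0 <= Rmin (INR k / 2) L <= L)
      by (pose proof (pos_INR k); split; [apply Rmin_glb; lra | apply Rmin_r]).
    split; [exact Hb|].
    rewrite Ei in Hd. unfold sample in Hd. apply le_INR in Hd.
    generalize (gdist_vtx (c1 a) (c (Rmin (INR k / 2) L)) (V1 a Ha) (V _ Hb)).
    generalize (gdist_vtx (c1 a) (c1 (INR i / 2)) (V1 a Ha) (V1 (INR i / 2) ltac:(lra))).
    rewrite D1 by lra. rewrite Rabs_pos_eq by lra.
    generalize (INR_wdist_triangle (vtx (c1 a)) (vtx (c1 (INR i / 2))) (vtx (c (Rmin (INR k / 2) L)))).
    lra. }
  destruct (Hcov i HiN) as [Hn|Hn].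
  - destruct (Hgo _ _ _ _ _ G2 Hn) as [b Hb]. exists b. now left.
  - destruct (Hgo _ _ _ _ _ G3 Hn) as [b Hb]. exists b. now right.
Qed.

(** * Continuous geodesics from geodesic words *)

Lemma gdist_sym p q : gdist G S p q = gdist G S q p.
Proof.
  unfold gdist.
  rewrite (wdist_sym (pv G p) (pv G q)), (wdist_sym (pv G p) (mul _ _)),
    (wdist_sym (mul (pv G p) _) (pv G q)), (wdist_sym (mul (pv G p) _) (mul _ _)).
  set (via := Rmin (Rmin _ _) (Rmin _ _)). set (via' := Rmin (Rmin _ _) (Rmin _ _)).
  assert (E : via = via').
  { unfold via, via', Rmin. repeat destruct (Rle_dec _ _); lra. }
  rewrite E, (Rabs_minus_sym (pt G p)).
  destruct (excluded_middle_informative _) as [[E1 E2]|N],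
    (excluded_middle_informative _) as [[F1 F2]|M]; auto.
  - destruct M; now rewrite E1, E2.
  - destruct N; now rewrite F1, F2.
Qed.

Lemma gdist_vertex g s s' : gdist G S (Pt G g s 0) (Pt G g s' 0) = 0.
Proof.
  unfold gdist. simpl. rewrite wdist_refl. simpl (INR 0).
  set (via := Rmin (Rmin _ _) (Rmin _ _)).
  assert (E : via = 0).
  { apply Rle_antisym; unfold via.
    - eapply Rle_trans; [apply Rmin_l|]. eapply Rle_trans; [apply Rmin_l|]. lra.
    - repeat apply Rmin_glb; repeat match goal with |- context [INR ?n] =>
        generalize (pos_INR n); generalize (INR n); intros end; lra. }
  rewrite E. destruct (excluded_middle_informative _); auto.
  rewrite Rminus_diag, Rabs_R0. apply Rmin_left. lra.
Qed.

Lemma geodesic_walk_nth u l e i j : walk u l -> length l = d u (endp u l) ->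
  (i <= j <= length l)%nat -> d (nth i (u :: l) e) (nth j (u :: l) e) = (j - i)%nat.
Proof.
  intros Hl Hn Hij.
  assert (H : forall i j, (i <= j <= length l)%nat ->
    (d (nth i (u :: l) e) (nth j (u :: l) e) <= j - i)%nat).
  { clear i j Hij. intros i j [Hij Hj]. induction Hij as [|j Hij IH]; [rewrite wdist_refl; lia|].
    generalize (wdist_edge _ _ (walk_nth u l j e Hl ltac:(lia))), (IH ltac:(lia)),
      (wdist_triangle (nth i (u :: l) e) (nth j (u :: l) e) (nth (Datatypes.S j) (u :: l) e)). lia. }
  pose proof (H 0%nat i ltac:(lia)). pose proof (H i j Hij).
  pose proof (H j (length l) ltac:(lia)) as Hj. rewrite nth_endp in Hj.
  pose proof (wdist_triangle u (nth i (u :: l) e) (endp u l)).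
  pose proof (wdist_triangle (nth i (u :: l) e) (nth j (u :: l) e) (endp u l)).
  simpl (nth 0 _ _) in *. lia.
Qed.

(** The point at time [t] lies on the edge leaving the vertex of index [fl t], the integer part of
    [t], at offset [t - INR (fl t)]. *)
Lemma geodesic_of_walk s0 u l : In s0 S -> walk u l -> length l = d u (endp u l) ->
  exists c, geodesic G S (Pt G u s0 0) (Pt G (endp u l) s0 0) (INR (length l)) c /\
    (forall i, (i <= length l)%nat -> vtx (c (INR i)) = nth i (u :: l) u) /\
    forall t, 0 <= t <= INR (length l) -> between u (endp u l) (vtx (c t)).
Proof.
  intros Hs0 Hl Hn. set (v := fun i => nth i (u :: l) u).
  assert (Hv : forall i j, (i <= j <= length l)%nat -> INR (d (v i) (v j)) = INR j - INR i).
  { intros i j Hij. unfold v. rewrite geodesic_walk_nth, minus_INR; auto. lia. }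
  (* Past the end of the walk any label in [S] will do; [s0] is the default. *)
  destruct (choice (fun i s => In s S /\ ((i < length l)%nat -> v (Datatypes.S i) = mul (v i) s)))
    as [s Hs].
  { intro i. destruct (le_lt_dec (length l) i) as [Hi|Hi].
    - exists s0. split; [auto | lia].
    - destruct (walk_nth u l i u Hl Hi) as [s [H1 H2]]. now exists s. }
  destruct (choice (fun t n => 0 <= t -> INR n <= t < INR n + 1)) as [fl Hfl].
  { intro t. destruct (Rle_lt_dec 0 t) as [H|H].
    - destruct (nat_floor t H) as [n Hn']. now exists n.
    - exists 0%nat. lra. }
  assert (Hpos : forall t, 0 <= t <= INR (length l) ->
    exists r, INR (fl t) = t - r /\ 0 <= r < 1 /\
      ((fl t < length l)%nat \/ fl t = length l /\ r = 0)).
  { intros t Ht. specialize (Hfl t (proj1 Ht)). exists (t - INR (fl t)).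
    split; [ring|]. split; [lra|].
    destruct (le_lt_dec (length l) (fl t)) as [H|H]; [right | now left].
    assert (H' : fl t = length l) by (apply Nat.le_antisymm; auto; apply INR_le; lra).
    rewrite H' in *. split; [auto | lra]. }
  assert (Hint : forall i, fl (INR i) = i).
  { intro i. specialize (Hfl (INR i) (pos_INR i)). rewrite <- !S_INR in Hfl.
    destruct Hfl as [H1 H2]. apply INR_le in H1. apply INR_lt in H2. lia. }
  set (c := fun t => Pt G (v (fl t)) (s (fl t)) (t - INR (fl t))).
  assert (Hmono : forall a b, 0 <= a <= INR (length l) -> 0 <= b <= INR (length l) -> a <= b ->
    gdist G S (c a) (c b) = b - a).
  { intros a b Ha Hb Hab.
    destruct (Hpos a Ha) as [t [Et [Ht Ht']]]. destruct (Hpos b Hb) as [r [Er [Hr Hr']]].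
    assert (Hij : (fl a <= fl b)%nat).
    { apply Nat.lt_succ_r, INR_lt. rewrite S_INR. lra. }
    unfold gdist, c. cbn [pv ps pt].
    generalize dependent (fl b). intros j Er Hr' Hij.
    generalize dependent (fl a). intros i Et Ht' Hij.
    assert (Hj : (j <= length l)%nat) by lia.
    replace (a - INR i) with t by lra. replace (b - INR j) with r by lra.
    assert (Ej : (j < length l)%nat -> mul (v j) (s j) = v (Datatypes.S j)) by (intro; symmetry; now apply Hs).
    assert (Ei : (i < length l)%nat -> mul (v i) (s i) = v (Datatypes.S i)) by (intro; symmetry; now apply Hs).
    destruct (Nat.eq_dec i j) as [Eij|Nij]; [subst j|];
      set (via := Rmin (Rmin _ _) (Rmin _ _)).
    - assert (Hvia : Rabs (t - r) <= via).
      { destruct Hr' as [Hi|[Hi Hr0]].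
        + unfold via. rewrite Ei by auto.
          pose proof (Hv i i ltac:(lia)). pose proof (Hv i (Datatypes.S i) ltac:(lia)) as H1.
          pose proof (Hv (Datatypes.S i) (Datatypes.S i) ltac:(lia)).
          rewrite (wdist_sym (v (Datatypes.S i)) (v i)).
          rewrite S_INR in *. unfold Rabs; destruct (Rcase_abs _); repeat apply Rmin_glb; lra.
        + destruct Ht' as [H|[_ Ht0]]; [lia|]. rewrite Hr0, Ht0, Rminus_diag, Rabs_R0.
          unfold via. repeat apply Rmin_glb; repeat match goal with |- context [INR ?n] =>
            generalize (pos_INR n); generalize (INR n); intros end; lra. }
      destruct (excluded_middle_informative _) as [_|N]; [|now destruct N].
      rewrite Rmin_right by auto. rewrite Rabs_left1; lra.
    - assert (Hi : (i < length l)%nat) by lia.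
      pose proof (Hv i j ltac:(lia)) as D1.
      pose proof (Hv (Datatypes.S i) j ltac:(lia)) as D2. rewrite S_INR in D2.
      assert (Hvia : via = b - a).
      { unfold via. rewrite Ei by auto. apply Rle_antisym.
        - eapply Rle_trans; [apply Rmin_r|]. eapply Rle_trans; [apply Rmin_l|]. lra.
        - destruct Hr' as [Hjl|[Hjl Hr0]].
          + rewrite Ej by auto. pose proof (Hv i (Datatypes.S j) ltac:(lia)).
            pose proof (Hv (Datatypes.S i) (Datatypes.S j) ltac:(lia)). rewrite !S_INR in *.
            repeat apply Rmin_glb; lra.
          (* At the final vertex the edge [s j] leaves the walk; its far end is one step from [v j],
             so a route through it is no shorter. *)
          + assert (He : edge (v j) (mul (v j) (s j))) by (exists (s j); split; [apply Hs | auto]).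
            apply edge_sym, wdist_edge, le_INR in He. simpl (INR 1) in He.
            pose proof (INR_wdist_triangle (v i) (mul (v j) (s j)) (v j)).
            pose proof (INR_wdist_triangle (v (Datatypes.S i)) (mul (v j) (s j)) (v j)).
            repeat apply Rmin_glb; lra. }
      destruct (excluded_middle_informative _) as [[E _]|_]; [|exact Hvia].
      exfalso. rewrite E, wdist_refl in D1. apply Nij, INR_eq. simpl (INR 0) in D1. lra. }
  assert (Hvtx : forall t, 0 <= t <= INR (length l) ->
    exists k, (k <= length l)%nat /\ vtx (c t) = v k).
  { intros t Ht. destruct (Hpos t Ht) as [r [Er [Hr Hr']]].
    unfold vtx, c. cbn [pv ps pt]. destruct (Rle_dec _ _) as [H|H].
    - exists (fl t). split; [lia | auto].
    - destruct Hr' as [Hi|[_ Hr0]]; [|lra].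
      exists (Datatypes.S (fl t)). split; [lia|]. symmetry. now apply Hs. }
  exists c. split; [split; [apply pos_INR | split; [|split; [|split]]] | split].
  - intros a Ha. destruct (Hpos a Ha) as [r [Er [Hr _]]]. split; cbn [c ps pt]; [apply Hs | lra].
  - unfold c. replace (fl 0) with 0%nat by (rewrite <- (Hint 0%nat); reflexivity).
    simpl (INR 0). rewrite Rminus_0_r. apply gdist_vertex.
  - unfold c. rewrite Hint, Rminus_diag. unfold v. rewrite nth_endp. apply gdist_vertex.
  - intros a b Ha Hb. destruct (Rle_lt_dec a b) as [H|H].
    + rewrite Rabs_left1, Hmono; auto; lra.
    + rewrite gdist_sym, Rabs_pos_eq, Hmono; auto; lra.
  - intros i Hi. unfold vtx, c. rewrite Hint, Rminus_diag. cbn [pv ps pt].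
    destruct (Rle_dec 0 (1 / 2)); [auto | lra].
  - intros t Ht. destruct (Hvtx t Ht) as [k [Hk ->]]. unfold between.
    pose proof (geodesic_walk_nth u l u 0 k Hl Hn ltac:(lia)) as H1.
    pose proof (geodesic_walk_nth u l u k (length l) Hl Hn ltac:(lia)) as H2.
    rewrite nth_endp in H2. unfold v. simpl (nth 0 _ _) in H1. lia.
Qed.

(** * Logarithmic triangulations *)

Lemma between_sym a b x : between a b x -> between b a x.
Proof.
  unfold between. rewrite (wdist_sym b x), (wdist_sym x a), (wdist_sym b a). lia.
Qed.

Definition discretely_thin (delta : nat) : Prop :=
  forall a b c x, between a b x ->
    exists x', (between a c x' \/ between b c x') /\ (d x x' <= delta)%nat.

(** The vertex [x] is put on the first side by joining geodesics from [a] to [x] and from [x] to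
    [b]. The margin of 1 in [delta'] is the rounding error of [gdist_vtx]. *)
Lemma discretely_thin_of_thin delta : thin_triangles G S delta ->
  exists delta', discretely_thin delta'.
Proof.
  intro Hthin. destruct (INR_unbounded (delta + 1)) as [delta' Hd]. exists delta'.
  intros a b c x Hx.
  destruct (geodesic_walk a x) as [l1 [W1 [E1 L1]]].
  destruct (geodesic_walk x b) as [l2 [W2 [E2 L2]]].
  assert (W : walk a (l1 ++ l2)) by (apply walk_app; rewrite E1; auto).
  assert (E : endp a (l1 ++ l2) = b) by (now rewrite endp_app, E1).
  assert (L : length (l1 ++ l2) = d a (endp a (l1 ++ l2))) by (rewrite E, length_app, L1, L2; apply Hx).
  destruct (geodesic_walk b c) as [p [Wp [Ep Lp]]].
  destruct (geodesic_walk c a) as [q [Wq [Eq Lq]]].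
  (* The degenerate side is treated apart because [S] may be empty; otherwise its first edge
     supplies a generator [s0]. *)
  destruct (Nat.eq_dec (length (l1 ++ l2)) 0) as [Z|Z].
  { exists a. rewrite length_app in Z. rewrite (wdist_sym x a), <- L1.
    split; [left; unfold between; rewrite wdist_refl|]; lia. }
  assert (Hs : exists s0, In s0 S).
  { destruct (l1 ++ l2) as [|v l]; [now destruct Z|]. destruct W as [[s [Hs _]] _]. now exists s. }
  destruct Hs as [s0 Hs0].
  assert (V : forall g, valid G S (Pt G g s0 0)) by (intro g; split; [auto | simpl; lra]).
  destruct (geodesic_of_walk s0 _ _ Hs0 W L) as [c1 [G1 [N1 _]]].
  destruct (geodesic_of_walk s0 _ _ Hs0 Wp ltac:(now rewrite Ep)) as [c2 [G2 [_ B2]]].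
  destruct (geodesic_of_walk s0 _ _ Hs0 Wq ltac:(now rewrite Eq)) as [c3 [G3 [_ B3]]].
  rewrite E in G1. rewrite Ep in *. rewrite Eq in *.
  assert (Hl1 : (length l1 <= length (l1 ++ l2))%nat) by (rewrite length_app; lia).
  assert (Ha : 0 <= INR (length l1) <= INR (length (l1 ++ l2)))
    by (split; [apply pos_INR | now apply le_INR]).
  assert (Hx1 : vtx (c1 (INR (length l1))) = x).
  { rewrite N1 by auto. rewrite <- firstn_endp by auto.
    now rewrite firstn_app, Nat.sub_diag, firstn_all, app_nil_r. }
  assert (Hfin : forall p q, valid G S p -> valid G S q -> gdist G S p q <= delta ->
    (d (vtx p) (vtx q) <= delta')%nat).
  { intros p' q' Vp Vq H. apply INR_le. generalize (gdist_vtx p' q' Vp Vq). lra. }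
  destruct (Hthin _ _ _ _ _ _ _ _ _ (V a) (V b) (V c) G1 G2 G3 _ Ha) as [t [[Ht H]|[Ht H]]].
  - exists (vtx (c2 t)). split; [right; now apply B2|].
    rewrite <- Hx1. apply Hfin; auto; [now apply G1 | now apply G2].
  - exists (vtx (c3 t)). split; [left; now apply between_sym, B3|].
    rewrite <- Hx1. apply Hfin; auto; [now apply G1 | now apply G3].
Qed.

(** Thinness of the triangle on [c i], [c j] and the vertex of middle index costs [delta] per
    halving; after [q] halvings at most one step, of length at most [C], remains. *)
Lemma near_path delta C q : discretely_thin delta -> forall (c : nat -> G) i j x,
  (i <= j)%nat -> (j - i <= 2 ^ q)%nat ->
  (forall k, (i <= k < j)%nat -> (d (c k) (c (Datatypes.S k)) <= C)%nat) ->
  between (c i) (c j) x ->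
  exists m, (i <= m <= j)%nat /\ (d x (c m) <= q * delta + C)%nat.
Proof.
  intros Ht c. induction q as [|q IH]; intros i j x Hij Hq HC Hx.
  - exists i. split; [lia|]. rewrite wdist_sym. unfold between in Hx.
    destruct (Nat.eq_dec i j) as [<-|N].
    + rewrite wdist_refl in Hx. lia.
    + simpl in Hq. replace j with (Datatypes.S i) in * by lia. specialize (HC i ltac:(lia)). lia.
  - rewrite Nat.pow_succ_r' in Hq. set (k := (i + (j - i) / 2)%nat).
    pose proof (Nat.div_mod_eq (j - i) 2). pose proof (Nat.mod_upper_bound (j - i) 2 ltac:(lia)).
    destruct (Ht (c i) (c j) (c k) x Hx) as [x' [[Hx'|Hx'] Hd]].
    + destruct (IH i k x') as [m [Hm Hm']]; [lia | lia | intros; apply HC; lia | auto |].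
      exists m. generalize (wdist_triangle x x' (c m)). lia.
    + destruct (IH k j x') as [m [Hm Hm']]; [lia | lia | intros; apply HC; lia | now apply between_sym |].
      exists m. generalize (wdist_triangle x x' (c m)). lia.
Qed.

(** A chord of length at most [4 D + 4] is split at the next vertex, which adds at most [C]. A
    longer one is split at some [c m] within [D] of its midpoint: the midpoint is farther than [D]
    from both ends, so [m] is interior, and half the chord plus [D] stays within the bound. *)
Lemma midpoint_split delta C q : discretely_thin delta -> forall (c : nat -> G) i j,
  (i + 2 <= j)%nat -> (j - i <= 2 ^ q)%nat ->
  (forall k, (i <= k < j)%nat -> (d (c k) (c (Datatypes.S k)) <= C)%nat) ->
  (d (c i) (c j) <= 4 * (q * delta + C) + C + 4)%nat ->
  exists m, (i < m < j)%nat /\ (d (c i) (c m) <= 4 * (q * delta + C) + C + 4)%nat /\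
    (d (c m) (c j) <= 4 * (q * delta + C) + C + 4)%nat.
Proof.
  intros Ht c i j Hij Hq HC Hd. set (D := (q * delta + C)%nat) in *.
  destruct (le_lt_dec (d (c i) (c j)) (4 * D + 4)) as [Hle|Hlt].
  - exists (i + 1)%nat. replace (i + 1)%nat with (Datatypes.S i) by lia.
    generalize (HC i ltac:(lia)), (wdist_triangle (c (Datatypes.S i)) (c i) (c j)),
      (wdist_sym (c (Datatypes.S i)) (c i)). lia.
  - pose proof (Nat.div_mod_eq (d (c i) (c j)) 2).
    pose proof (Nat.mod_upper_bound (d (c i) (c j)) 2 ltac:(lia)).
    destruct (between_exists (c i) (c j) (d (c i) (c j) / 2)) as [x [Hx Hix]]; [lia|].
    destruct (near_path delta C q Ht c i j x ltac:(lia) Hq HC Hx) as [m [Hm Hm']].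
    fold D in Hm'. unfold between in Hx. exists m.
    pose proof (wdist_triangle (c i) x (c m)). pose proof (wdist_triangle (c m) x (c j)).
    rewrite (wdist_sym (c m) x) in *.
    assert (m <> i) by (intros ->; rewrite (wdist_sym x) in Hm'; lia).
    assert (m <> j) by (intros ->; lia).
    lia.
Qed.
End Metric.

(** * Change of generating set and conclusion *)

Lemma wdist_change (G : Grp) (S T : list G) : fin_sym_gen G S -> fin_sym_gen G T ->
  exists C, forall u v, (wdist G T u v <= C * wdist G S u v)%nat.
Proof.
  intros HS HT.
  assert (H : forall l : list G, exists C, forall s, In s l -> (word_len G T s <= C)%nat).
  { induction l as [|s l [C HC]]; [exists 0%nat; intros s []|].
    exists (word_len G T s + C)%nat. intros s' [<-|Hs']; [lia|]. specialize (HC _ Hs'). lia. }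
  destruct (H S) as [C HC]. exists C. intros u v.
  destruct (geodesic_walk S HS u v) as [l [Hl [<- <-]]].
  revert u Hl; induction l as [|w l IH]; intros u Hl; simpl.
  - rewrite wdist_refl; auto. lia.
  - destruct Hl as [[s [Hs ->]] Hl]. specialize (IH _ Hl). specialize (HC s Hs).
    assert (E : wdist G T u (mul u s) = word_len G T s) by (unfold wdist; now rewrite mulKg).
    generalize (wdist_triangle T HT u (mul u s) (endp (mul u s) l)). lia.
Qed.

(** All splitting takes place in the metric of [S]; the factor [C] is applied once to each finished
    chord and does not accumulate. *)
Lemma ktri_of_splits (G : Grp) (S T : list G) C k c n :
  (forall u v, (wdist G T u v <= C * wdist G S u v)%nat) ->
  (forall i j, (1 <= i)%nat -> (i + 2 <= j <= n)%nat -> (wdist G S (c i) (c j) <= k)%nat ->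
     exists m, (i < m < j)%nat /\ (wdist G S (c i) (c m) <= k)%nat /\
       (wdist G S (c m) (c j) <= k)%nat) ->
  forall i j, (1 <= i < j)%nat -> (j <= n)%nat ->
    j = Datatypes.S i \/ (wdist G S (c i) (c j) <= k)%nat -> ktri G T (C * k) c i j.
Proof.
  intros HC Hsplit i j. remember (j - i)%nat as len eqn:Hlen.
  revert i j Hlen; induction len as [len IH] using lt_wf_ind; intros i j Hlen Hij Hj Hd.
  destruct (Nat.eq_dec j (Datatypes.S i)) as [->|N]; [constructor|].
  destruct Hd as [->|Hd]; [now destruct N|].
  destruct (Hsplit i j ltac:(lia) ltac:(lia) Hd) as [m [Hm [H1 H2]]].
  assert (forall u v, (wdist G S u v <= k)%nat -> (wdist G T u v <= C * k)%nat).
  { intros u v H. eapply Nat.le_trans; [apply HC|]. now apply Nat.mul_le_mono_l. }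
  apply kt_split with (m := m); try lia; auto.
  - apply (IH (m - i)%nat); auto; lia.
  - apply (IH (j - m)%nat); auto; lia.
Qed.

Lemma log2_up_le n : (1 <= n)%nat -> INR (Nat.log2_up n) <= log2 (INR n) + 1.
Proof.
  intro Hn. unfold log2.
  assert (Hl2 : 0 < ln 2) by (rewrite <- ln_1; apply ln_increasing; lra).
  destruct (Nat.eq_dec n 1) as [->|N].
  - simpl. rewrite ln_1. unfold Rdiv. lra.
  - destruct (Nat.log2_up_spec n ltac:(lia)) as [H _].
    pose proof (Nat.log2_up_pos n ltac:(lia)) as Hp.
    set (q := Nat.log2_up n) in *.
    apply lt_INR in H. rewrite pow_INR in H. change (INR 2) with 2 in H.
    apply ln_increasing in H; [|apply pow_lt; lra]. rewrite ln_pow in H by lra.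
    replace (INR (Nat.pred q)) with (INR q - 1) in H
      by (replace q with (Datatypes.S (Nat.pred q)) at 1 by lia; rewrite S_INR; ring).
    apply (Rmult_le_reg_r (ln 2)); [auto|].
    replace ((ln (INR n) / ln 2 + 1) * ln 2) with (ln (INR n) + ln 2) by (field; lra). lra.
Qed.

Lemma log_chords_of_thin (G : Grp) (S T : list G) delta : fin_sym_gen G S -> fin_sym_gen G T ->
  discretely_thin S delta ->
  exists Q Rc : R, forall n : nat, (1 <= n)%nat ->
    INR (DeltaS G T n) <= Q * log2 (INR n) + Rc.
Proof.
  intros HS HT Hthin.
  destruct (wdist_change G S T HS HT) as [C2 H2]. destruct (wdist_change G T S HT HS) as [C1 H1].
  exists (4 * INR C2 * INR delta), (4 * INR C2 * INR delta + INR C2 * (5 * INR C1 + 4)).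
  intros n Hn. set (q := Nat.log2_up n).
  assert (HD : (DeltaS G T n <= C2 * (4 * (q * delta + C1) + C1 + 4))%nat).
  { apply DeltaS_le. intros m c Hm [Hc Hc0].
    destruct (le_lt_dec m 3) as [H3|H3]; [now left | right].
    assert (Hstep : forall i, (i < m)%nat -> (wdist G S (c i) (c (Datatypes.S i)) <= C1)%nat).
    { intros i Hi. destruct (Hc (Datatypes.S i) ltac:(lia)) as [s Hs].
      replace (Datatypes.S i - 1)%nat with i in Hs by lia.
      pose proof (wdist_edge T (c i) (c (Datatypes.S i)) (ex_intro _ s Hs)).
      specialize (H1 (c i) (c (Datatypes.S i))). nia. }
    apply (ktri_of_splits G S T C2 _ c m H2); [|lia | lia |].
    - intros i j Hi Hj. apply midpoint_split; auto; [lia | |].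
      + apply Nat.le_trans with n; [lia|]. unfold q.
        destruct (Nat.eq_dec n 1) as [->|N]; [simpl; lia|]. apply Nat.log2_up_spec. lia.
      + intros k Hk. apply Hstep. lia.
    (* The side closing the polygon from 1 to [m] is the first edge of the cycle, because
       [c m = c 0]. *)
    - right. rewrite Hc0, wdist_sym by auto. specialize (Hstep 0%nat ltac:(lia)). lia. }
  apply le_INR in HD. eapply Rle_trans; [exact HD|].
  rewrite !mult_INR, !plus_INR, !mult_INR, plus_INR, mult_INR.
  replace (INR 4) with 4 by (simpl; lra).
  pose proof (log2_up_le n Hn) as Hq. fold q in Hq.
  assert (0 <= INR C2 * INR delta) by (apply Rmult_le_pos; apply pos_INR).
  nra.
Qed.

(** The inequality [ln y <= y] is used at [y = b * x] with [b] small enough that [a * b <= e];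
    dividing by [a + 1] allows [Q = 0]. *)
Lemma log2_sublinear (Q e : R) : 0 < e -> exists K, forall x, 1 <= x -> Q * log2 x <= e * x + K.
Proof.
  intro He. unfold log2.
  assert (Hl2 : 0 < ln 2) by (rewrite <- ln_1; apply ln_increasing; lra).
  set (a := Rabs Q / ln 2). assert (Ha : 0 <= a).
  { apply Rmult_le_pos; [apply Rabs_pos | left; now apply Rinv_0_lt_compat]. }
  set (b := e / (a + 1)). assert (Hb : 0 < b) by (apply Rdiv_lt_0_compat; lra).
  exists (- a * ln b). intros x Hx.
  assert (Hlx : 0 <= ln x) by (rewrite <- ln_1; destruct (Req_dec x 1) as [->|N]; [lra | left; apply ln_increasing; lra]).
  assert (H1 : ln (b * x) <= b * x).
  { assert (0 < b * x) by nra. generalize (exp_ineq1_le (ln (b * x))). rewrite exp_ln by auto. lra. }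
  rewrite ln_mult in H1 by lra.
  assert (H2 : Q * (ln x / ln 2) <= a * ln x).
  { unfold a. replace (Rabs Q / ln 2 * ln x) with (Rabs Q * (ln x / ln 2)) by (field; lra).
    apply Rmult_le_compat_r; [|apply Rle_abs].
    apply Rmult_le_pos; [auto | left; now apply Rinv_0_lt_compat]. }
  assert (H3 : (a + 1) * b = e) by (unfold b; field; lra).
  nra.
Qed.

Lemma hyperbolic_of_linear_chords (G : Grp) (S : list G) (K : R) : fin_sym_gen G S ->
  (forall n, (1 <= n)%nat -> INR (DeltaS G S n) <= INR n / 6 + K) -> hyperbolic G.
Proof.
  intros HS HK. exists S. split; [exact HS|].
  destruct (slim_of_linear_chords S HS K HK) as [r0 Hr]. exists (INR r0 + 3).
  now apply thin_of_slim.
Qed.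

Theorem theoremB (G : Grp) :
  finitely_generated G ->
  ((exists S : list G, fin_sym_gen G S /\
      exists K : R, forall n : nat, (1 <= n)%nat ->
        INR (DeltaS G S n) <= INR n / 6 + K)
   <-> hyperbolic G)
  /\
  (hyperbolic G <->
   (forall S : list G, fin_sym_gen G S ->
      exists Q Rc : R, forall n : nat, (1 <= n)%nat ->
        INR (DeltaS G S n) <= Q * log2 (INR n) + Rc)).
Proof.
  intros [S0 HS0].
  assert (H12 : (exists S : list G, fin_sym_gen G S /\
      exists K : R, forall n : nat, (1 <= n)%nat ->
        INR (DeltaS G S n) <= INR n / 6 + K) -> hyperbolic G).
  { intros [S [HS [K HK]]]. now apply (hyperbolic_of_linear_chords G S K). }
  assert (H23 : hyperbolic G -> forall T : list G, fin_sym_gen G T ->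
      exists Q Rc : R, forall n : nat, (1 <= n)%nat ->
        INR (DeltaS G T n) <= Q * log2 (INR n) + Rc).
  { intros [S [HS [delta Hd]]] T HT.
    destruct (discretely_thin_of_thin S HS delta Hd) as [delta' Hd'].
    now apply (log_chords_of_thin G S T delta'). }
  assert (H31 : (forall S : list G, fin_sym_gen G S ->
      exists Q Rc : R, forall n : nat, (1 <= n)%nat ->
        INR (DeltaS G S n) <= Q * log2 (INR n) + Rc) ->
    exists S : list G, fin_sym_gen G S /\
      exists K : R, forall n : nat, (1 <= n)%nat -> INR (DeltaS G S n) <= INR n / 6 + K).
  (* Finite generation enters here: it supplies a generating set to which the universally quantified
     bound applies. *)
  { intro H. exists S0. split; [exact HS0|]. destruct (H S0 HS0) as [Q [Rc HQ]].
    destruct (log2_sublinear Q (1 / 6) ltac:(lra)) as [K HK]. exists (K + Rc).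
    intros n Hn. generalize (HQ n Hn), (HK (INR n) ltac:(apply (le_INR 1); auto)). lra. }
  tauto.
Qed.
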